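(* Assume that $\mathsf{IST}$ is consistent. Then there is no sentence $\Phi$ of the $\in$-language (the language of $\mathsf{ZFC}$) such that the equivalence $\Phi \leftrightarrow (\ast)$ is a theorem of $\mathsf{IST}$, where $(\ast)$ is the $\mathsf{IST}$-sentence $$\forall F\,\Big[\,\forall^{\mathrm{st}} n\,\big(F(n)\text{ is standard}\big)\;\longrightarrow\;\exists^{\mathrm{st}} G\;\forall^{\mathrm{st}} n\,\big(F(n)=G(n)\big)\Big],$$ in which $n$ ranges over natural numbers and $F,G$ range over functions defined on the natural numbers (taking arbitrary values).
   Context: $\mathsf{IST}$ (Nelson's internal set theory) is formulated in the language with $=$, $\in$ and a unary predicate $\mathrm{st}$ (''standard''). Formulas not mentioning $\mathrm{st}$ are called internal ($\in$-formulas). Abbreviations: $\exists^{\mathrm{st}}x\,\varphi$ means $\exists x(\mathrm{st}(x)\wedge\varphi)$, $\forall^{\mathrm{st}}x\,\varphi$ means $\forall x(\mathrm{st}(x)\to\varphi)$, and $\forall^{\mathrm{st\,fin}}A$ means ''for all standard finite $A$''. $\mathsf{IST}$ consists of all axioms of $\mathsf{ZFC}$ (with Separation and Replacement only for internal formulas) together with the schemes: Idealization: $\forall^{\mathrm{st\,fin}}A\,\exists x\,\forall a\in A\,\Phi(x,a)\leftrightarrow\exists x\,\forall^{\mathrm{st}}a\,\Phi(x,a)$ for every internal $\Phi$ (arbitrary parameters); Standardization: $\forall^{\mathrm{st}}X\,\exists^{\mathrm{st}}Y\,\forall^{\mathrm{st}}x\,[x\in Y\leftrightarrow x\in X\wedge\Phi(x)]$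 for every formula $\Phi$ of the $\mathsf{IST}$ language (arbitrary parameters); Transfer: $\exists x\,\Phi(x)\to\exists^{\mathrm{st}}x\,\Phi(x)$ for every internal $\Phi$ all of whose parameters are standard. *)

(* Defs.v *)
From Stdlib Require Import List Arith.
Import ListNotations.

(** * Syntax: variables are de Bruijn indices (there are no function
    symbols, so terms are variables). *)
Inductive form : Type :=
| FEq  : nat -> nat -> form
| FMem : nat -> nat -> form
| FSt  : nat -> form
| FBot : form
| FImp : form -> form -> form
| FAll : form -> form.               (* binds index 0 *)

Definition FNot p := FImp p FBot.
Definition FTop := FNot FBot.
Definition FOr p q := FImp (FNot p) q.
Definition FAnd p q := FNot (FImp p (FNot q)).
Definition FIff p q := FAnd (FImp p q) (FImp q p).
Definition FEx p := FNot (FAll (FNot p)).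

Fixpoint internal (p : form) : Prop :=
  match p with
  | FSt _ => False
  | FImp p q => internal p /\ internal q
  | FAll p => internal p
  | _ => True
  end.

Fixpoint bounded (n : nat) (p : form) : Prop :=
  match p with
  | FEq i j | FMem i j => i < n /\ j < n
  | FSt i => i < n
  | FBot => True
  | FImp p q => bounded n p /\ bounded n q
  | FAll p => bounded (S n) p
  end.

Definition upr (r : nat -> nat) (i : nat) : nat :=
  match i with 0 => 0 | S k => S (r k) end.
Fixpoint ren (r : nat -> nat) (p : form) : form :=
  match p with
  | FEq i j => FEq (r i) (r j)
  | FMem i j => FMem (r i) (r j)
  | FSt i => FSt (r i)
  | FBot => FBot
  | FImp p q => FImp (ren r p) (ren r q)
  | FAll p => FAll (ren (upr r) p)
  end.
Definition scons (t : nat) (r : nat -> nat) (i : nat) : nat :=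
  match i with 0 => t | S k => r k end.
Definition inst (t : nat) (p : form) : form := ren (scons t (fun k => k)) p.

(** * Hilbert calculus (rules: modus ponens and generalization).
    Non-closed axioms of a theory stand for their universal closures. *)
Inductive LogAx : form -> Prop :=
| LA1 p q : LogAx (FImp p (FImp q p))
| LA2 p q r : LogAx (FImp (FImp p (FImp q r)) (FImp (FImp p q) (FImp p r)))
| LA3 p : LogAx (FImp (FNot (FNot p)) p)
| LA4 p t : LogAx (FImp (FAll p) (inst t p))
| LA5 p q : LogAx (FImp (FAll (FImp p q)) (FImp (FAll p) (FAll q)))
| LA6 p : LogAx (FImp p (FAll (ren S p)))
| LA7 i : LogAx (FEq i i)
| LA8 p i j : LogAx (FImp (FEq i j) (FImp (inst i p) (inst j p))).

Inductive Prv (T : form -> Prop) : form -> Prop :=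
| PAx p : T p -> Prv T p
| PLog p : LogAx p -> Prv T p
| PMP p q : Prv T (FImp p q) -> Prv T p -> Prv T q
| PGen p : Prv T p -> Prv T (FAll p).

Definition Consistent (T : form -> Prop) : Prop := ~ Prv T FBot.

(** * Builder with named binders: a formula under construction is a
    function of the current binder depth; a bound variable is represented by
    its de Bruijn level. *)
Definition bf := nat -> form.
Definition bEq (x y : nat) : bf := fun d => FEq (d - x - 1) (d - y - 1).
Definition bIn (x y : nat) : bf := fun d => FMem (d - x - 1) (d - y - 1).
Definition bSt (x : nat) : bf := fun d => FSt (d - x - 1).
Definition bImp (p q : bf) : bf := fun d => FImp (p d) (q d).
Definition bNot (p : bf) : bf := fun d => FNot (p d).
Definition bAnd (p q : bf) : bf := fun d => FAnd (p d) (q d).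
Definition bOr (p q : bf) : bf := fun d => FOr (p d) (q d).
Definition bIff (p q : bf) : bf := fun d => FIff (p d) (q d).
Definition bAll (f : nat -> bf) : bf := fun d => FAll (f d (S d)).
Definition bEx (f : nat -> bf) : bf := fun d => FEx (f d (S d)).
(** [emb vs Φ]: insert a raw formula Φ, whose indices 0..|vs|-1 denote the
    bound variables listed in vs (levels) and whose remaining indices
    |vs|, |vs|+1, ... are its parameters = free variables 0, 1, ... of the
    whole axiom. *)
Definition emb (vs : list nat) (p : form) : bf := fun d =>
  ren (fun i => if i <? length vs then d - nth i vs 0 - 1
                else d + (i - length vs)) p.

Definition bEmpty e := bAll (fun z => bNot (bIn z e)).
Definition bSucc y s := bAll (fun z => bIff (bIn z s) (bOr (bIn z y) (bEq z y))).
Definition bInd I :=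
  bAnd (bEx (fun e => bAnd (bEmpty e) (bIn e I)))
       (bAll (fun y => bImp (bIn y I) (bEx (fun s => bAnd (bSucc y s) (bIn s I))))).
Definition bNat x := bAll (fun I => bImp (bInd I) (bIn x I)).
Definition bPair a b p :=
  bAll (fun z => bIff (bIn z p)
    (bOr (bAll (fun w => bIff (bIn w z) (bEq w a)))
         (bAll (fun w => bIff (bIn w z) (bOr (bEq w a) (bEq w b)))))).
Definition bApp F a b := bEx (fun p => bAnd (bIn p F) (bPair a b p)).
Definition bFunc F :=
  bAnd (bAll (fun p => bImp (bIn p F) (bEx (fun a => bEx (fun b => bPair a b p)))))
       (bAll (fun a => bAll (fun b => bAll (fun b' =>
          bImp (bAnd (bApp F a b) (bApp F a b')) (bEq b b'))))).
Definition bFunOnNat F :=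
  bAnd (bFunc F) (bAll (fun a => bIff (bEx (fun b => bApp F a b)) (bNat a))).
Definition bFin A :=
  bEx (fun n => bAnd (bNat n) (bEx (fun f => bAnd (bFunc f)
    (bAnd (bAll (fun a => bIff (bEx (fun b => bApp f a b)) (bIn a n)))
    (bAnd (bAll (fun b => bIff (bIn b A) (bEx (fun a => bApp f a b))))
          (bAll (fun a => bAll (fun a' => bAll (fun b =>
             bImp (bAnd (bApp f a b) (bApp f a' b)) (bEq a a')))))))))).

Definition ax_ext : form := bAll (fun x => bAll (fun y =>
  bImp (bAll (fun z => bIff (bIn z x) (bIn z y))) (bEq x y))) 0.
Definition ax_found : form := bAll (fun x =>
  bImp (bEx (fun y => bIn y x))
       (bEx (fun y => bAnd (bIn y x) (bNot (bEx (fun z => bAnd (bIn z y) (bIn z x))))))) 0.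
Definition ax_pair : form := bAll (fun x => bAll (fun y =>
  bEx (fun z => bAnd (bIn x z) (bIn y z)))) 0.
Definition ax_union : form := bAll (fun F => bEx (fun A => bAll (fun Y => bAll (fun x =>
  bImp (bAnd (bIn x Y) (bIn Y F)) (bIn x A))))) 0.
Definition ax_inf : form := bEx (fun X => bInd X) 0.
Definition ax_pow : form := bAll (fun x => bEx (fun y => bAll (fun z =>
  bImp (bAll (fun w => bImp (bIn w z) (bIn w x))) (bIn z y)))) 0.
Definition ax_choice : form := bAll (fun X =>
  bImp (bAnd (bAll (fun x => bImp (bIn x X) (bEx (fun w => bIn w x))))
             (bAll (fun x => bAll (fun y => bImp (bAnd (bIn x X) (bAnd (bIn y X) (bNot (bEq x y))))
                                   (bNot (bEx (fun w => bAnd (bIn w x) (bIn w y)))))))) 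
       (bEx (fun C => bAll (fun x => bImp (bIn x X) (bEx (fun c =>
          bAnd (bIn c x) (bAnd (bIn c C) (bAll (fun c' =>
             bImp (bAnd (bIn c' x) (bIn c' C)) (bEq c' c)))))))))) 0.
Definition ax_sep (φ : form) : form := bAll (fun x => bEx (fun y => bAll (fun z =>
  bIff (bIn z y) (bAnd (bIn z x) (emb [z; x] φ))))) 0.
Definition ax_repl (φ : form) : form := bAll (fun A =>
  bImp (bAll (fun x => bImp (bIn x A) (bEx (fun y => bAnd (emb [x; y; A] φ)
          (bAll (fun y' => bImp (emb [x; y'; A] φ) (bEq y y')))))))
       (bEx (fun B => bAll (fun x => bImp (bIn x A)
          (bEx (fun y => bAnd (bIn y B) (emb [x; y; A] φ))))))) 0.

Definition ax_ideal (Φ : form) : form := bIff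
  (bAll (fun A => bImp (bAnd (bSt A) (bFin A))
     (bEx (fun x => bAll (fun a => bImp (bIn a A) (emb [x; a] Φ))))))
  (bEx (fun x => bAll (fun a => bImp (bSt a) (emb [x; a] Φ)))) 0.
Definition ax_stand (Φ : form) : form := bAll (fun X => bImp (bSt X)
  (bEx (fun Y => bAnd (bSt Y) (bAll (fun x => bImp (bSt x)
     (bIff (bIn x Y) (bAnd (bIn x X) (emb [x] Φ)))))))) 0.
(** Transfer: Φ(x, params) internal with parameters among free variables
    0..n-1 (index 0 of Φ is x), all assumed standard *)
Fixpoint stconj (n : nat) : form :=
  match n with 0 => FTop | S k => FAnd (FSt k) (stconj k) end.
Definition ax_transfer (n : nat) (Φ : form) : form :=
  FImp (stconj n) (FImp (FEx Φ) (FEx (FAnd (FSt 0) Φ))).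

Inductive IST_ax : form -> Prop :=
| IExt : IST_ax ax_ext
| IFound : IST_ax ax_found
| IPair : IST_ax ax_pair
| IUnion : IST_ax ax_union
| IInf : IST_ax ax_inf
| IPow : IST_ax ax_pow
| IChoice : IST_ax ax_choice
| ISep φ : internal φ -> IST_ax (ax_sep φ)
| IRepl φ : internal φ -> IST_ax (ax_repl φ)
| IIdeal Φ : internal Φ -> IST_ax (ax_ideal Φ)
| IStand Φ : IST_ax (ax_stand Φ)
| ITransfer n Φ : internal Φ -> bounded (S n) Φ -> IST_ax (ax_transfer n Φ).

Definition star : form := bAll (fun F => bImp (bFunOnNat F)
  (bImp (bAll (fun n => bImp (bAnd (bSt n) (bNat n))
           (bEx (fun v => bAnd (bApp F n v) (bSt v)))))
        (bEx (fun G => bAnd (bSt G) (bAnd (bFunOnNat G)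
           (bAll (fun n => bImp (bAnd (bSt n) (bNat n))
              (bEx (fun v => bAnd (bApp F n v) (bApp G n v)))))))))) 0.

(* Main.v *)
(** Work in a model of IST. By reflection there are standard levels [M] of the
    cumulative hierarchy that reflect any given finite list of ∈-formulas, and
    these can be chosen of countable or of uncountable cofinality. Such an [M],
    with the standardness predicate inherited from the whole model, satisfies
    Idealization, Standardization and Transfer, because these schemes can be
    relativized to the standard set [M], which contains every subset of each of
    its elements. If [M] has a standard cofinal sequence [g] of length ω, then
    Idealization yields [F] in [M] agreeing with [g] on the standard numbers,
    while a standard [G] agreeing with [F] there would be [g] itself, which is
    not in [M]: the sentence (∗) fails in [M]. If [M] has uncountable
    cofinality, the standardization of [F] is a standard function from ω to
    [M], hence an element of [M]: (∗) holds in [M]. An ∈-sentence equivalent to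
    (∗) in IST would have the same truth value in both levels, because both
    reflect it and the finitely many axioms used in the proof. *)
From Stdlib Require Import List Arith Lia Classical ClassicalEpsilon.
From Stdlib Require Import FunctionalExtensionality PropExtensionality Cantor.
Require Import Defs.
Import ListNotations.

(** * Semantics *)

(** Consistency is a syntactic hypothesis, so the model comes from a completeness proof for the
    given calculus. A derivation of the equivalence uses finitely many axioms; the formula [p0]
    packs the internal ones together with Φ and the notions occurring in (∗) and in Idealization,
    and only subformulas of [p0] are ever reflected. The schemes speak of formulas, while the set
    theory is written with Rocq predicates on the model. The predicate [df] connects the two and
    records separately whether a defining formula is internal and whether its parameters are
    standard. Ordinals are avoided. Uncountable cofinality comes from a Hartogs argument on
    reflecting levels: for a reflecting level [A], those that have at most [A] many reflecting
    levels up to them form a set with no cofinal family indexed by elements of [A]; as [A] contains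
    the natural numbers, the union of that set has no cofinal sequence of length ω. Both kinds of
    level are first found without regard to standardness. Their definitions have only standard
    parameters, so Transfer then supplies standard ones. *)

Definition ec {X : Type} (x : X) (r : nat -> X) (i : nat) : X :=
  match i with 0 => x | S k => r k end.

Lemma ec_comp {X Y : Type} (f : X -> Y) x r :
  (fun i => f (ec x r i)) = ec (f x) (fun i => f (r i)).
Proof. apply functional_extensionality; intros [|i]; reflexivity. Qed.

(** Quantifiers range over a predicate [dom] on the carrier, so that the whole model and the
    submodel on a set share carrier, membership and environments. *)
Fixpoint satd {D : Type} (mem : D -> D -> Prop) (st dom : D -> Prop)
  (r : nat -> D) (p : form) : Prop :=
  match p with
  | FEq i j => r i = r j
  | FMem i j => mem (r i) (r j)
  | FSt i => st (r i)
  | FBot => False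
  | FImp p q => satd mem st dom r p -> satd mem st dom r q
  | FAll p => forall x, dom x -> satd mem st dom (ec x r) p
  end.

Section Semantics.
Context {D : Type} (mem : D -> D -> Prop) (st dom : D -> Prop).
Notation "r |= p" := (satd mem st dom r p) (at level 70).

Lemma satd_ren p : forall f r, r |= ren f p <-> (fun i => r (f i)) |= p.
Proof.
  induction p as [i j|i j|i| |p IHp q IHq|p IHp]; intros f r; simpl; try tauto.
  - rewrite IHp, IHq. tauto.
  - assert (E : forall x, (fun i => ec x r (upr f i)) = ec x (fun i => r (f i))).
    { intro x; apply functional_extensionality; intros [|i]; reflexivity. }
    split; intros H x Hx; [rewrite <- E; apply IHp|apply IHp; rewrite E]; auto.
Qed.

Lemma satd_bounded p : forall n r r', bounded n p ->
  (forall i, i < n -> r i = r' i) -> (r |= p <-> r' |= p).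
Proof.
  induction p as [i j|i j|i| |p IHp q IHq|p IHp]; simpl; intros n r r' B E; try tauto.
  - rewrite !E by tauto. tauto.
  - rewrite !E by tauto. tauto.
  - rewrite !E by tauto. tauto.
  - rewrite (IHp n r r'), (IHq n r r') by tauto. tauto.
  - assert (F : forall x, ec x r |= p <-> ec x r' |= p).
    { intro x. apply (IHp (S n)); auto. intros [|i] Hi; simpl; auto. apply E; lia. }
    split; intros H x Hx; apply F; auto.
Qed.

Lemma satd_inst t p r : r |= inst t p <-> ec (r t) r |= p.
Proof.
  unfold inst. rewrite satd_ren.
  replace (fun i => r (scons t (fun k => k) i)) with (ec (r t) r); [tauto|].
  apply functional_extensionality; intros [|i]; reflexivity.
Qed.

Lemma satd_and r p q : r |= FAnd p q <-> r |= p /\ r |= q.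
Proof. simpl; tauto. Qed.
Lemma satd_or r p q : r |= FOr p q <-> r |= p \/ r |= q.
Proof. simpl; tauto. Qed.
Lemma satd_iff r p q : r |= FIff p q <-> (r |= p <-> r |= q).
Proof. simpl; tauto. Qed.
Lemma satd_ex r p : r |= FEx p <-> exists x, dom x /\ ec x r |= p.
Proof.
  simpl. split.
  - intro H. apply NNPP. intro N. apply H. intros x Hx Hp. eauto.
  - intros [x [Hx Hp]] H. apply (H x); auto.
Qed.

Lemma logax_sound p : LogAx p -> forall r, (forall i, dom (r i)) -> r |= p.
Proof.
  destruct 1; intros rr Hr; simpl; auto.
  - tauto.
  - intro H. apply satd_inst. auto.
  - intros H x _. apply satd_ren. exact H.
  - intros E H. apply satd_inst in H. apply satd_inst. rewrite <- E. exact H.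
Qed.

Lemma soundness (T : form -> Prop) p : Prv T p ->
  (forall q, T q -> forall r, (forall i, dom (r i)) -> r |= q) ->
  forall r, (forall i, dom (r i)) -> r |= p.
Proof.
  intros H HT. induction H as [p Hp|p Hp|p q H1 IH1 H2 IH2|p H IH]; intros r Hr.
  - auto.
  - apply logax_sound; auto.
  - apply (IH1 r Hr), IH2; auto.
  - intros x Hx. apply IH. intros [|i]; simpl; auto.
Qed.
End Semantics.

(** * Syntax *)

Lemma ren_ext_bounded p : forall n f g, bounded n p ->
  (forall i, i < n -> f i = g i) -> ren f p = ren g p.
Proof.
  induction p as [i j|i j|i| |p IHp q IHq|p IHp]; simpl; intros n f g B E; try reflexivity.
  - rewrite !E by tauto. auto.
  - rewrite !E by tauto. auto.
  - rewrite !E by tauto. auto.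
  - rewrite (IHp n f g), (IHq n f g) by tauto. auto.
  - f_equal. apply (IHp (S n)); auto. intros [|i] Hi; simpl; auto.
    f_equal. apply E; lia.
Qed.

Lemma ren_comp p : forall f g, ren f (ren g p) = ren (fun i => f (g i)) p.
Proof.
  induction p as [i j|i j|i| |p IHp q IHq|p IHp]; simpl; intros f g; try reflexivity.
  - rewrite IHp, IHq. reflexivity.
  - f_equal. rewrite IHp. f_equal.
    apply functional_extensionality; intros [|i]; reflexivity.
Qed.

Lemma ren_id p : ren (fun i => i) p = p.
Proof.
  induction p as [i j|i j|i| |p IHp q IHq|p IHp]; simpl; try congruence.
  f_equal. rewrite <- IHp at 2. f_equal.
  apply functional_extensionality; intros [|i]; reflexivity.
Qed.

(** A crude bound on the free variables, with sums in place of maxima and no decrease under a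
    quantifier; only finiteness matters. *)
Fixpoint nb (p : form) : nat :=
  match p with
  | FEq i j | FMem i j => S (i + j)
  | FSt i => S i
  | FBot => 0
  | FImp p q => nb p + nb q
  | FAll p => nb p
  end.

Lemma bounded_mono p : forall n m, bounded n p -> n <= m -> bounded m p.
Proof.
  induction p as [i j|i j|i| |p IHp q IHq|p IHp]; simpl; intros n m H L; try lia.
  - destruct H; split; eauto.
  - apply (IHp (S n)); auto; lia.
Qed.

Lemma bounded_nb p : bounded (nb p) p.
Proof.
  induction p as [i j|i j|i| |p IHp q IHq|p IHp]; simpl; auto; try lia.
  - split; eapply bounded_mono; eauto; lia.
  - eapply bounded_mono; eauto.
Qed.

Lemma internal_ren p : forall f, internal p -> internal (ren f p).
Proof.
  induction p as [i j|i j|i| |p IHp q IHq|p IHp]; simpl; intros f H; auto.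
  destruct H; auto.
Qed.

Fixpoint code (p : form) : nat :=
  match p with
  | FEq i j => to_nat (0, to_nat (i, j))
  | FMem i j => to_nat (1, to_nat (i, j))
  | FSt i => to_nat (2, i)
  | FBot => to_nat (3, 0)
  | FImp p q => to_nat (4, to_nat (code p, code q))
  | FAll p => to_nat (5, code p)
  end.

Lemma code_inj p : forall q, code p = code q -> p = q.
Proof.
  induction p as [i j|i j|i| |p IHp q IHq|p IHp]; intros [a b|a b|a| |a b|a]; cbn -[to_nat];
    intro E; apply to_nat_inj in E; try discriminate E; apply pair_equal_spec in E; destruct E as [_ E];
    try (apply to_nat_inj, pair_equal_spec in E; destruct E as [E E']); f_equal; auto.
Qed.

(** Numbers that code nothing decode to an arbitrary formula: the enumeration of all formulas only
    has to be surjective. *)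
Definition decode (n : nat) : form := epsilon (inhabits FBot) (fun p => code p = n).

Lemma decode_code p : decode (code p) = p.
Proof.
  apply code_inj. unfold decode.
  apply (epsilon_spec (inhabits FBot) (fun q => code q = code p)). eauto.
Qed.

(** * Completeness *)

Section Completeness.
Variable T : form -> Prop.
Hypothesis HT : Consistent T.

Lemma Prv_id p : Prv T (FImp p p).
Proof.
  eapply PMP; [eapply PMP; [apply PLog, (LA2 p (FImp p p) p)|]|]; apply PLog, LA1.
Qed.

(** The calculus has no substitution rule. Generalizing [n] times and instantiating with [LA4]
    imitates a simultaneous renaming of the first [n] variables, which is enough because a formula
    has finitely many. *)
Lemma Prv_inst_all n : forall p, Prv T p -> forall f,
  exists g, (forall i, i < n -> g i = f i) /\ Prv T (ren g p).
Proof.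
  induction n as [|n IH]; intros p Hp f.
  - exists (fun i => i). split; [lia|]. rewrite ren_id. exact Hp.
  - destruct (IH (FAll p) (PGen _ _ Hp) (fun i => f (S i))) as [g [Hg Pg]].
    exists (scons (f 0) g). split.
    + intros [|i] Hi; simpl; auto. apply Hg. lia.
    + assert (E : ren (scons (f 0) g) p = inst (f 0) (ren (upr g) p)).
      { unfold inst. rewrite ren_comp. f_equal.
        apply functional_extensionality; intros [|i]; reflexivity. }
      rewrite E. eapply PMP; [apply PLog, LA4|exact Pg].
Qed.

Lemma Prv_ren p f : Prv T p -> Prv T (ren f p).
Proof.
  intro H. destruct (Prv_inst_all (nb p) p H f) as [g [Hg Pg]].
  rewrite <- (ren_ext_bounded p (nb p) g f (bounded_nb p) Hg). exact Pg.
Qed.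

(** No generalization over assumptions: free variables act as constants. *)
Inductive Der (G : form -> Prop) : form -> Prop :=
| Dthm p : Prv T p -> Der G p
| Dass p : G p -> Der G p
| Dmp p q : Der G (FImp p q) -> Der G p -> Der G q.

Lemma Der_ded G q p : Der (fun x => x = q \/ G x) p -> Der G (FImp q p).
Proof.
  induction 1 as [p H|p [->|H]|p p' H1 IH1 H2 IH2].
  - eapply Dmp; [apply Dthm, PLog, LA1|apply Dthm; auto].
  - apply Dthm, Prv_id.
  - eapply Dmp; [apply Dthm, PLog, LA1|apply Dass; auto].
  - eapply Dmp; [eapply Dmp; [apply Dthm, PLog, LA2|exact IH1]|exact IH2].
Qed.

Lemma Der_mono (G G' : form -> Prop) p :
  (forall q, G q -> G' q) -> Der G p -> Der G' p.
Proof.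
  intro H. induction 1; [apply Dthm|apply Dass|eapply Dmp]; eauto.
Qed.

Lemma Der_ren (G : form -> Prop) f p : Der G p ->
  Der (fun x => exists q, G q /\ x = ren f q) (ren f p).
Proof.
  induction 1 as [p H|p H|p p' H1 IH1 H2 IH2].
  - apply Dthm, Prv_ren, H.
  - apply Dass; eauto.
  - eapply Dmp; [exact IH1|exact IH2].
Qed.

Lemma Der_gen (G : form -> Prop) p :
  Der (fun x => exists q, G q /\ x = ren S q) p -> Der G (FAll p).
Proof.
  induction 1 as [p H|p [q [H ->]]|p p' H1 IH1 H2 IH2].
  - apply Dthm, PGen, H.
  - eapply Dmp; [apply Dthm, PLog, LA6|apply Dass, H].
  - eapply Dmp; [eapply Dmp; [apply Dthm, PLog, LA5|exact IH1]|exact IH2].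
Qed.

Lemma Der_fresh (G : form -> Prop) v p : (forall q, G q -> bounded v q) ->
  bounded (S v) p -> Der G (inst v p) -> Der G (FAll p).
Proof.
  intros HG Hp H. apply Der_gen.
  (* This renaming moves the fresh variable [v] to index 0, which undoes the instantiation, and
     agrees with [S] on formulas bounded by [v]. *)
  set (f := fun i => if i =? v then 0 else S i).
  apply (Der_ren _ f) in H.
  assert (E : ren f (inst v p) = p).
  { unfold inst. rewrite ren_comp. rewrite <- (ren_id p) at 2.
    apply (ren_ext_bounded p (S v)); auto. unfold f. intros [|i] Hi; simpl.
    - rewrite Nat.eqb_refl. auto.
    - destruct (Nat.eqb_spec i v); auto. lia. }
  rewrite E in H. revert H. apply Der_mono. intros q [q' [Hq ->]].
  exists q'. split; auto. apply (ren_ext_bounded q' v); auto.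
  unfold f. intros i Hi. destruct (Nat.eqb_spec i v); auto. lia.
Qed.

Lemma Der_dne G p : Der (fun x => x = FNot p \/ G x) FBot -> Der G p.
Proof.
  intro H. apply Der_ded in H. eapply Dmp; [apply Dthm, PLog, LA3|exact H].
Qed.

Definition nbl (L : list form) : nat := fold_right (fun p n => nb p + n) 0 L.

Lemma nbl_spec L q : In q L -> bounded (nbl L) q.
Proof.
  induction L as [|a L IH]; simpl; intros H; [tauto|]. destruct H as [->|H].
  - apply (bounded_mono q (nb q)); [apply bounded_nb|lia].
  - apply (bounded_mono q (nbl L)); [auto|unfold nbl; lia].
Qed.

Definition incons (L : list form) : Prop := Der (fun x => In x L) FBot.

(** The Henkin step: a negated universal formula receives as counterexample the free variable
    [nbl L], which occurs in no formula of [L]. *)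
Definition witness (q : form) (L : list form) : list form :=
  match q with
  | FImp (FAll p) FBot => FNot (inst (nbl L) p) :: L
  | _ => L
  end.

Fixpoint stage (n : nat) : list form :=
  match n with
  | 0 => []
  | S n => if excluded_middle_informative (incons (decode n :: stage n))
           then stage n else witness (decode n) (decode n :: stage n)
  end.

Lemma witness_incl q L p : In p L -> In p (witness q L).
Proof.
  intro H. destruct q as [| | | |a b|]; simpl; auto.
  destruct a; simpl; auto. destruct b; simpl; auto.
Qed.

Lemma witness_cons q L : In q L -> ~ incons L -> ~ incons (witness q L).
Proof.
  intros Hq HL. destruct q as [| | | |a b|]; simpl; auto.
  destruct a as [| | | | |p]; simpl; auto. destruct b; simpl; auto.
  intro H. apply HL.
  assert (H1 : Der (fun x => In x L) (FAll p)).
  { apply (Der_fresh _ (nbl L)).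
    - intros x Hx. apply nbl_spec, Hx.
    - apply nbl_spec in Hq. simpl in Hq. tauto.
    - apply Der_dne. revert H. apply Der_mono. simpl. intuition. }
  eapply Dmp; [apply Dass, Hq|exact H1].
Qed.

Lemma stage_cons n : ~ incons (stage n).
Proof.
  induction n as [|n IH]; simpl.
  - intro H. apply HT. unfold incons in H. revert H. generalize FBot. intros b H.
    induction H; [auto|contradiction|]. eapply PMP; eauto.
  - destruct (excluded_middle_informative _) as [H|H]; auto.
    apply witness_cons; simpl; auto.
Qed.

Lemma stage_mono n m p : n <= m -> In p (stage n) -> In p (stage m).
Proof.
  induction 1 as [|m L IH]; auto. intro H. simpl.
  destruct (excluded_middle_informative _); auto.
  apply witness_incl. simpl; auto.
Qed.

Definition Gam (p : form) : Prop := exists n, In p (stage n).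

Lemma Gam_compact p : Der Gam p -> exists n, Der (fun x => In x (stage n)) p.
Proof.
  induction 1 as [p H|p [n H]|p q _ [n IH1] _ [m IH2]].
  - exists 0. apply Dthm; auto.
  - exists n. apply Dass; auto.
  - exists (n + m). apply (Dmp _ p).
    + revert IH1. apply Der_mono. intro. apply stage_mono. lia.
    + revert IH2. apply Der_mono. intro. apply stage_mono. lia.
Qed.

Lemma Gam_cons : ~ Der Gam FBot.
Proof. intro H. destruct (Gam_compact _ H) as [n Hn]. exact (stage_cons n Hn). Qed.

(** The formula [p] is examined at stage [code p]; being consistent with all of [Gam], it is
    consistent with what is present there, so it is accepted together with its witness. *)
Lemma Gam_add p : ~ Der (fun x => x = p \/ Gam x) FBot ->
  Gam p /\ forall q, p = FNot (FAll q) -> exists v, Gam (FNot (inst v q)).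
Proof.
  intro H.
  assert (Hs : In p (stage (S (code p))) /\
    forall q, p = FNot (FAll q) -> exists v, In (FNot (inst v q)) (stage (S (code p)))).
  { simpl. rewrite decode_code. destruct (excluded_middle_informative _) as [I|I].
    - exfalso. apply H. revert I. apply Der_mono. simpl.
      intros q [<-|Hq]; auto. right. eexists; eauto.
    - split; [apply witness_incl; simpl; auto|].
      generalize (stage (code p)). intros L q ->. eexists. left. reflexivity. }
  destruct Hs as [H1 H2]. split; [eexists; eauto|].
  intros q Hq. destruct (H2 q Hq) as [v Hv]. exists v. eexists; eauto.
Qed.

Lemma Gam_der p : Der Gam p -> Gam p.
Proof.
  intro H. apply Gam_add. intro I. apply Gam_cons.
  eapply Dmp; [apply Der_ded, I|exact H].
Qed.

Lemma Gam_not p : ~ Gam p -> Gam (FNot p).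
Proof.
  intro H. apply Gam_der. apply Der_ded. apply NNPP. intro I.
  apply H. apply Gam_add, I.
Qed.

Lemma Gam_bot : ~ Gam FBot.
Proof. intro H. apply Gam_cons, Dass, H. Qed.

Lemma Gam_imp p q : Gam (FImp p q) <-> (Gam p -> Gam q).
Proof.
  split.
  - intros H Hp. apply Gam_der. eapply Dmp; apply Dass; eauto.
  - intro H. apply Gam_der, Der_ded. destruct (classic (Gam p)) as [Hp|Hp].
    + apply Dass. auto.
    + apply Gam_not in Hp. apply Der_dne. eapply Dmp with p.
      * apply Dass. auto.
      * apply Dass. auto.
Qed.

Lemma Gam_all p : Gam (FAll p) <-> forall v, Gam (inst v p).
Proof.
  split.
  - intros H v. apply Gam_der. eapply Dmp; [apply Dthm, PLog, LA4|apply Dass, H].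
  - intro H. apply NNPP. intro N. apply Gam_not in N.
    assert (I : ~ Der (fun x => x = FNot (FAll p) \/ Gam x) FBot).
    { intro I. apply Gam_cons. revert I. apply Der_mono. intros q [->|]; auto. }
    destruct (proj2 (Gam_add _ I) p eq_refl) as [v Hv].
    apply Gam_bot. apply (proj1 (Gam_imp _ _) Hv), H.
Qed.

Lemma Gam_log p : LogAx p -> Gam p.
Proof. intro H. apply Gam_der, Dthm, PLog, H. Qed.

Definition eqv (i j : nat) : Prop := Gam (FEq i j).

Lemma eqv_subst p i j : eqv i j -> Gam (inst i p) -> Gam (inst j p).
Proof.
  intros H Hp. apply (Gam_imp (inst i p)); auto.
  apply (Gam_imp (FEq i j)); auto. apply Gam_log, LA8.
Qed.

Lemma eqv_refl i : eqv i i.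
Proof. apply Gam_log, LA7. Qed.
Lemma eqv_sym i j : eqv i j -> eqv j i.
Proof. intro H. apply (eqv_subst (FEq 0 (S i)) i j H), eqv_refl. Qed.
Lemma eqv_trans i j k : eqv i j -> eqv j k -> eqv i k.
Proof. intros H1 H2. apply (eqv_subst (FEq (S i) 0) j k H2), H1. Qed.

(** [satd] reads [FEq] as Leibniz equality, so the term model has to be a true quotient. Equivalent
    variables have extensionally equal predicates [eqv i], hence the same chosen representative. *)
Definition rep (i : nat) : nat := epsilon (inhabits 0) (eqv i).

Lemma rep_eqv i : eqv i (rep i).
Proof. apply (epsilon_spec (inhabits 0) (eqv i)). exists i. apply eqv_refl. Qed.

Lemma rep_eq i j : eqv i j <-> rep i = rep j.
Proof.
  split; intro H.
  - unfold rep. f_equal. apply functional_extensionality; intro k.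
    apply propositional_extensionality.
    split; intro K; eapply eqv_trans; eauto. apply eqv_sym; auto.
  - apply eqv_trans with (rep i); [apply rep_eqv|].
    rewrite H. apply eqv_sym, rep_eqv.
Qed.

Definition HD : Type := {i : nat | rep i = i}.
Definition cls (i : nat) : HD :=
  exist (fun i => rep i = i) (rep i) (eq_sym (proj1 (rep_eq i (rep i)) (rep_eqv i))).
Definition hmem (x y : HD) : Prop := Gam (FMem (proj1_sig x) (proj1_sig y)).
Definition hst (x : HD) : Prop := Gam (FSt (proj1_sig x)).

Lemma cls_eq i j : cls i = cls j <-> eqv i j.
Proof.
  rewrite rep_eq. split; intro H.
  - exact (f_equal (@proj1_sig _ _) H).
  - apply eq_sig_hprop; [intros; apply proof_irrelevance|exact H].
Qed.

Lemma cls_proj x : cls (proj1_sig x) = x.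
Proof.
  destruct x as [i Hi]. apply eq_sig_hprop; [intros; apply proof_irrelevance|exact Hi].
Qed.

Lemma truth p : forall f,
  satd hmem hst (fun _ => True) (fun i => cls (f i)) p <-> Gam (ren f p).
Proof.
  induction p as [i j|i j|i| |p IHp q IHq|p IHp]; intro f; simpl.
  - apply cls_eq.
  - unfold hmem. simpl. split; intro H.
    + apply (eqv_subst (FMem 0 (S (f j))) (rep (f i))); [apply eqv_sym, rep_eqv|].
      apply (eqv_subst (FMem (S (rep (f i))) 0) (rep (f j))); [apply eqv_sym, rep_eqv|].
      exact H.
    + apply (eqv_subst (FMem 0 (S (rep (f j)))) (f i)); [apply rep_eqv|].
      apply (eqv_subst (FMem (S (f i)) 0) (f j)); [apply rep_eqv|]. exact H.
  - unfold hst. simpl. split; intro H.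
    + apply (eqv_subst (FSt 0) (rep (f i))); [apply eqv_sym, rep_eqv|exact H].
    + apply (eqv_subst (FSt 0) (f i)); [apply rep_eqv|exact H].
  - split; [tauto|]. intro H. exact (Gam_bot H).
  - rewrite IHp, IHq, Gam_imp. tauto.
  - rewrite Gam_all.
    assert (E : forall v, inst v (ren (upr f) p) = ren (scons v f) p).
    { intro v. unfold inst. rewrite ren_comp. f_equal.
      apply functional_extensionality; intros [|i]; reflexivity. }
    assert (E2 : forall v, ec (cls v) (fun i => cls (f i)) = fun i => cls (scons v f i)).
    { intro v. apply functional_extensionality; intros [|i]; reflexivity. }
    split.
    + intros H v. rewrite E. apply IHp. rewrite <- E2. auto.
    + intros H x _. rewrite <- (cls_proj x), E2. apply IHp. rewrite <- E. auto.
Qed.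

Lemma completeness : exists (D : Type) (mem : D -> D -> Prop) (st : D -> Prop),
  inhabited D /\ forall p, T p -> forall r, satd mem st (fun _ => True) r p.
Proof.
  exists HD, hmem, hst. split; [constructor; exact (cls 0)|].
  intros p Hp r.
  replace r with (fun i => cls (proj1_sig (r i)))
    by (apply functional_extensionality; intro; apply cls_proj).
  apply truth. apply Gam_der, Dthm, Prv_ren, PAx, Hp.
Qed.
End Completeness.

Lemma Prv_finite (T : form -> Prop) p : Prv T p ->
  exists L, (forall q, In q L -> T q) /\ Prv (fun q => In q L) p.
Proof.
  assert (W : forall L L' q, (forall x : form, In x L -> In x L') ->
    Prv (fun x => In x L) q -> Prv (fun x => In x L') q).
  { intros L L' q I H. induction H; [apply PAx|apply PLog|eapply PMP|apply PGen]; eauto. }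
  induction 1 as [p H|p H|p q _ [L1 [H1 P1]] _ [L2 [H2 P2]]|p _ [L [H1 P1]]].
  - exists [p]. split; [|apply PAx; simpl; auto]. intros q [->|[]]; auto.
  - exists []. split; [simpl; tauto|apply PLog; auto].
  - exists (L1 ++ L2). split.
    + intros x Hx. apply in_app_or in Hx. destruct Hx; auto.
    + apply (PMP _ p).
      * revert P1. apply W. intros; apply in_or_app; auto.
      * revert P2. apply W. intros; apply in_or_app; auto.
  - exists L. split; auto. apply PGen; auto.
Qed.

(** * Definability in a model of IST *)

(** Even indices carry the variables and odd ones the parameters of a definition, so that neither
    supply has to be bounded by an arity. *)
Definition mix {X : Type} (f g : nat -> X) (i : nat) : X :=
  if Nat.even i then f (Nat.div2 i) else g (Nat.div2 i).

Lemma mix_even {X} (f g : nat -> X) i : mix f g (2 * i) = f i.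
Proof.
  unfold mix. rewrite Nat.div2_double.
  replace (Nat.even (2 * i)) with true; auto. symmetry. apply Nat.even_spec. exists i; lia.
Qed.

Lemma mix_odd {X} (f g : nat -> X) i : mix f g (S (2 * i)) = g i.
Proof.
  unfold mix. rewrite Nat.div2_succ_double. rewrite Nat.even_succ, Nat.odd_mul. auto.
Qed.

Lemma mix_comp {X Y} (h : X -> Y) f g :
  (fun i => h (mix f g i)) = mix (fun i => h (f i)) (fun i => h (g i)).
Proof.
  apply functional_extensionality; intro i. unfold mix. destruct (Nat.even i); auto.
Qed.

Lemma mix_ext {X} (f g f' g' : nat -> X) : (forall i, f i = f' i) -> (forall i, g i = g' i) ->
  mix f g = mix f' g'.
Proof.
  intros H1 H2. apply functional_extensionality; intro i. unfold mix.
  destruct (Nat.even i); auto.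
Qed.

Section IST.
Context {D : Type} (mem : D -> D -> Prop) (st : D -> Prop).
Hypothesis inhD : inhabited D.
Hypothesis HN : forall p, IST_ax p -> forall r, satd mem st (fun _ => True) r p.
Notation sat := (satd mem st (fun _ => True)).
Local Notation "x ∈ y" := (mem x y) (at level 70).
Local Notation "x ∉ y" := (~ mem x y) (at level 70).
Local Notation env := (nat -> D).

Lemma sem_all r p (P : D -> Prop) :
  (forall x, sat (ec x r) p <-> P x) -> (sat r (FAll p) <-> forall x, P x).
Proof. simpl. intro H. split; intros K x; [|intros _]; apply H; auto. Qed.
Lemma sem_ex r p (P : D -> Prop) :
  (forall x, sat (ec x r) p <-> P x) -> (sat r (FEx p) <-> exists x, P x).
Proof.
  intro H. rewrite satd_ex. split; intros [x K]; exists x; [|split; auto]; apply H; tauto.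
Qed.
Lemma sem_imp dom r p q (P Q : Prop) :
  (satd mem st dom r p <-> P) -> (satd mem st dom r q <-> Q) ->
  (satd mem st dom r (FImp p q) <-> (P -> Q)).
Proof. simpl. tauto. Qed.
Lemma sem_not dom r p (P : Prop) : (satd mem st dom r p <-> P) ->
  (satd mem st dom r (FNot p) <-> ~ P).
Proof. simpl. tauto. Qed.
Lemma sem_and dom r p q (P Q : Prop) :
  (satd mem st dom r p <-> P) -> (satd mem st dom r q <-> Q) ->
  (satd mem st dom r (FAnd p q) <-> P /\ Q).
Proof. rewrite satd_and. tauto. Qed.
Lemma sem_or dom r p q (P Q : Prop) :
  (satd mem st dom r p <-> P) -> (satd mem st dom r q <-> Q) ->
  (satd mem st dom r (FOr p q) <-> P \/ Q).
Proof. rewrite satd_or. tauto. Qed.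
Lemma sem_iff dom r p q (P Q : Prop) :
  (satd mem st dom r p <-> P) -> (satd mem st dom r q <-> Q) ->
  (satd mem st dom r (FIff p q) <-> (P <-> Q)).
Proof. rewrite satd_iff. tauto. Qed.

Lemma semd_all (dom : D -> Prop) r p (P : D -> Prop) :
  (forall x, dom x -> (satd mem st dom (ec x r) p <-> P x)) ->
  (satd mem st dom r (FAll p) <-> forall x, dom x -> P x).
Proof. simpl. intro H. split; intros K x Hx; apply H; auto. Qed.
Lemma semd_ex (dom : D -> Prop) r p (P : D -> Prop) :
  (forall x, dom x -> (satd mem st dom (ec x r) p <-> P x)) ->
  (satd mem st dom r (FEx p) <-> exists x, dom x /\ P x).
Proof.
  intro H. rewrite satd_ex. split; intros [x [Hx K]]; exists x; split; auto; apply H; auto.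
Qed.

Ltac sem_with all ex := repeat (cbv beta; lazymatch goal with
  | |- satd _ _ _ _ (bAll _ _) <-> _ => all ()
  | |- satd _ _ _ _ (bEx _ _) <-> _ => ex ()
  | |- satd _ _ _ _ (bImp _ _ _) <-> _ => apply sem_imp
  | |- satd _ _ _ _ (bNot _ _) <-> _ => apply sem_not
  | |- satd _ _ _ _ (bAnd _ _ _) <-> _ => apply sem_and
  | |- satd _ _ _ _ (bOr _ _ _) <-> _ => apply sem_or
  | |- satd _ _ _ _ (bIff _ _ _) <-> _ => apply sem_iff
  | |- satd _ _ _ _ (bIn _ _ _) <-> _ => apply iff_refl
  | |- satd _ _ _ _ (bEq _ _ _) <-> _ => apply iff_refl
  | |- satd _ _ _ _ (bSt _ _) <-> _ => apply iff_refl
  end).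
Ltac sem := sem_with ltac:(fun _ => apply sem_all; intro) ltac:(fun _ => apply sem_ex; intro).
Ltac semd := sem_with ltac:(fun _ => apply semd_all; intros ? ?)
                      ltac:(fun _ => apply semd_ex; intros ? ?).

Definition Emp e := forall z, z ∉ e.
Definition Suc y s := forall z, z ∈ s <-> z ∈ y \/ z = y.
Definition Ind I :=
  (exists e, Emp e /\ e ∈ I) /\ forall y, y ∈ I -> exists s, Suc y s /\ s ∈ I.
Definition isNat x := forall I, Ind I -> x ∈ I.
Definition Op a b p :=
  forall z, z ∈ p <-> (forall w, w ∈ z <-> w = a) \/ (forall w, w ∈ z <-> w = a \/ w = b).
Definition App F a b := exists p, p ∈ F /\ Op a b p.
Definition Func F := (forall p, p ∈ F -> exists a b, Op a b p) /\
  forall a b b', App F a b /\ App F a b' -> b = b'.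
Definition FunNat F := Func F /\ forall a, (exists b, App F a b) <-> isNat a.
Definition Fin A := exists n, isNat n /\ exists f, Func f /\
  (forall a, (exists b, App f a b) <-> a ∈ n) /\
  (forall b, b ∈ A <-> exists a, App f a b) /\
  forall a a' b, App f a b /\ App f a' b -> a = a'.

Ltac semu := unfold Fin, FunNat, Func, App, isNat, Ind, Emp, Suc, Op,
  bFin, bFunOnNat, bFunc, bApp, bNat, bInd, bEmpty, bSucc, bPair; sem.

(** The raw formula of a notion depends on the binder levels and the depth at which it stands, so
    each occurrence in [ax_ideal] or [star] has its own reading. *)
Lemma sat_Fin r : sat r (bFin 0 1) <-> Fin (r 0).
Proof. semu. Qed.
Lemma sat_FunNat0 r : sat r (bFunOnNat 0 1) <-> FunNat (r 0).
Proof. semu. Qed.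
Lemma sat_FunNat1 r : sat r (bFunOnNat 1 2) <-> FunNat (r 0).
Proof. semu. Qed.
Lemma sat_Nat1 r : sat r (bNat 1 2) <-> isNat (r 0).
Proof. semu. Qed.
Lemma sat_Nat2 r : sat r (bNat 2 3) <-> isNat (r 0).
Proof. semu. Qed.
Lemma sat_App012 r : sat r (bApp 0 1 2 3) <-> App (r 2) (r 1) (r 0).
Proof. semu. Qed.
Lemma sat_App023 r : sat r (bApp 0 2 3 4) <-> App (r 3) (r 1) (r 0).
Proof. semu. Qed.
Lemma sat_App123 r : sat r (bApp 1 2 3 4) <-> App (r 2) (r 1) (r 0).
Proof. semu. Qed.

Lemma stconj_spec dom n r : satd mem st dom r (stconj n) <-> forall i, i < n -> st (r i).
Proof.
  induction n as [|n IH]; cbn [stconj].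
  - simpl. split; [lia|tauto].
  - rewrite satd_and, IH. simpl. split.
    + intros [H1 H2] i Hi. destruct (Nat.eq_dec i n) as [->|]; auto. apply H2; lia.
    + intro H. split; auto.
Qed.

Lemma transfer_form p r : internal p -> (forall i, st (r i)) ->
  (exists x, sat (ec x r) p) -> exists x, st x /\ sat (ec x r) p.
Proof.
  intros Hp Hr [x Hx].
  assert (B : bounded (S (nb p)) p) by (apply (bounded_mono p (nb p)); [apply bounded_nb|lia]).
  pose proof (HN _ (ITransfer _ _ Hp B) r) as H. unfold ax_transfer in H.
  assert (K : sat r (FEx (FAnd (FSt 0) p))).
  { apply H; [apply stconj_spec; auto|]. apply satd_ex. eauto. }
  apply satd_ex in K. destruct K as [y [_ K]]. apply satd_and in K.
  exists y. exact K.
Qed.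

Lemma st_inhabited : exists x, st x.
Proof.
  destruct inhD as [d].
  pose proof (HN _ (ITransfer 0 (FEq 0 0) I (conj (le_n 1) (le_n 1))) (fun _ => d)) as H.
  assert (K : sat (fun _ => d) (FEx (FAnd (FSt 0) (FEq 0 0)))).
  { apply H; [simpl; tauto|]. apply satd_ex. exists d. simpl; auto. }
  apply satd_ex in K. destruct K as [y [_ K]]. apply satd_and in K. exists y. apply K.
Qed.

(** A standard default value: it fills empty places in environments without spoiling the
    standardness of the parameters. *)
Definition s0 : D := proj1_sig (constructive_indefinite_description _ st_inhabited).
Lemma st_s0 : st s0.
Proof. exact (proj2_sig (constructive_indefinite_description _ st_inhabited)). Qed.

(** [df b1 b2 P]: [P] is defined by a formula with parameters; the formula is
    internal if [b1], the parameters are standard if [b2]. *)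
Definition df (b1 b2 : bool) (P : env -> Prop) : Prop :=
  exists p r0, (b1 = true -> internal p) /\ (b2 = true -> forall i, st (r0 i)) /\
    forall r, P r <-> sat (mix r r0) p.

Definition tm (b2 : bool) (t : env -> D) : Prop :=
  (exists i, t = fun r => r i) \/ exists c, (b2 = true -> st c) /\ t = fun _ => c.

Section Df.
Context {b1 b2 : bool}.
Local Notation df := (df b1 b2).
Local Notation tm := (tm b2).

Lemma tm_var i : tm (fun r => r i).
Proof. left. exists i. reflexivity. Qed.
Lemma tm_cst c : (b2 = true -> st c) -> tm (fun _ => c).
Proof. right. exists c. auto. Qed.
Lemma tm_comp t f : tm t -> tm (fun r => t (fun i => r (f i))).
Proof.
  intros [[i ->]|[c [Hc ->]]]; [left; exists (f i)|right; exists c]; auto.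
Qed.
Lemma tm_s0 : tm (fun _ => s0).
Proof. apply tm_cst. intros _. apply st_s0. Qed.

Lemma df_ext (P Q : env -> Prop) : (forall r, P r <-> Q r) -> df P -> df Q.
Proof.
  intros H [p [r0 [H1 [H2 H3]]]]. exists p, r0. split; [|split]; auto.
  intro r. rewrite <- H. auto.
Qed.

Lemma df_imp P Q : df P -> df Q -> df (fun r => P r -> Q r).
Proof.
  intros [p [r0 [H1 [H2 H3]]]] [q [r1 [K1 [K2 K3]]]].
  (* The two parameter lists are interleaved in turn: parameter [i] of [p] becomes parameter
     [2 * i], and that of [q] becomes parameter [S (2 * i)]. *)
  exists (FImp (ren (mix (fun i => 2 * i) (fun i => S (2 * (2 * i)))) p)
          (ren (mix (fun i => 2 * i) (fun i => S (2 * S (2 * i)))) q)), (mix r0 r1).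
  split; [|split].
  - simpl. intro E. split; apply internal_ren; auto.
  - intros E i. unfold mix. destruct (Nat.even i); auto.
  - intro r. rewrite H3, K3. symmetry. apply sem_imp.
    + rewrite satd_ren, mix_comp. erewrite (mix_ext _ _ r r0); [apply iff_refl| |].
      * intro i. apply mix_even.
      * intro i. rewrite mix_odd, mix_even. auto.
    + rewrite satd_ren, mix_comp. erewrite (mix_ext _ _ r r1); [apply iff_refl| |].
      * intro i. apply mix_even.
      * intro i. rewrite mix_odd, mix_odd. auto.
Qed.

(** A proposition that does not depend on the environment is true or false, so top or bottom defines
    it, even if it mentions [st]. *)
Lemma df_cst (P : Prop) : df (fun _ => P).
Proof.
  destruct (classic P) as [H|H].
  - exists FTop, (fun _ => s0). split; [simpl; auto|]. split.
    + intros _ _. apply st_s0.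
    + simpl. tauto.
  - exists FBot, (fun _ => s0). split; [simpl; auto|]. split.
    + intros _ _. apply st_s0.
    + simpl. tauto.
Qed.

Lemma df_not P : df P -> df (fun r => ~ P r).
Proof. intro H. apply df_imp; [exact H|apply df_cst]. Qed.
Lemma df_or P Q : df P -> df Q -> df (fun r => P r \/ Q r).
Proof.
  intros H K. apply (df_ext (fun r => ~ P r -> Q r)); [intro; tauto|].
  apply df_imp; [apply df_not|]; auto.
Qed.
Lemma df_and P Q : df P -> df Q -> df (fun r => P r /\ Q r).
Proof.
  intros H K. apply (df_ext (fun r => ~ (P r -> ~ Q r))); [intro; tauto|].
  apply df_not, df_imp; [|apply df_not]; auto.
Qed.
Lemma df_iff P Q : df P -> df Q -> df (fun r => P r <-> Q r).
Proof. intros H K. apply df_and; apply df_imp; auto. Qed.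

Lemma df_all (P : env -> D -> Prop) :
  df (fun r => P (fun i => r (S i)) (r 0)) -> df (fun r => forall x, P r x).
Proof.
  intros [p [r0 [H1 [H2 H3]]]].
  (* Variable 0 becomes the bound one. Under the new binder the other variables keep the even places
     of [mix r r0] and the parameters its odd places, all shifted by one. *)
  exists (FAll (ren (mix (fun i => match i with 0 => 0 | S k => S (2 * k) end)
                         (fun i => S (S (2 * i)))) p)), r0.
  split; [|split]; auto.
  - simpl. intro E. apply internal_ren; auto.
  - intro r. symmetry. apply sem_all. intro x. rewrite satd_ren, mix_comp.
    rewrite (mix_ext _ _ (ec x r) r0).
    + symmetry. apply (H3 (ec x r)).
    + intros [|i]; auto. apply (mix_even r r0 i).
    + intro i. apply (mix_odd r r0 i).
Qed.
Lemma df_ex (P : env -> D -> Prop) :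
  df (fun r => P (fun i => r (S i)) (r 0)) -> df (fun r => exists x, P r x).
Proof.
  intro H. apply (df_ext (fun r => ~ forall x, ~ P r x)).
  - intro r. split.
    + intro N. apply not_all_not_ex, N.
    + intros [x Hx] N. apply (N x Hx).
  - apply df_not. apply (df_all (fun r x => ~ P r x)). apply df_not, H.
Qed.

Lemma df_atom (q : nat -> nat -> form) (R : D -> D -> Prop) t t' :
  (forall i j, internal (q i j)) -> (forall r i j, sat r (q i j) <-> R (r i) (r j)) ->
  tm t -> tm t' -> df (fun r => R (t r) (t' r)).
Proof.
  intros Hq HR Ht Ht'.
  assert (V2 : exists i j r0, (b2 = true -> forall i, st (r0 i)) /\
            forall r, mix r r0 i = t r /\ mix r r0 j = t' r).
  { destruct Ht as [[i ->]|[c [Hc ->]]], Ht' as [[j ->]|[c' [Hc' ->]]].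
    - exists (2 * i), (2 * j), (fun _ => s0). split; [intros; apply st_s0|].
      intro. rewrite !mix_even. auto.
    - exists (2 * i), 1, (fun _ => c'). split; auto.
      intro. rewrite !mix_even. auto.
    - exists 1, (2 * j), (fun _ => c). split; auto.
      intro. rewrite !mix_even. auto.
    - exists 1, 3, (fun i => if i =? 0 then c else c'). split; auto.
      intros E [|i]; simpl; auto. }
  destruct V2 as [i [j [r0 [H1 H2]]]]. exists (q i j), r0.
  split; [auto|split; auto]. intro r. rewrite HR. destruct (H2 r) as [-> ->]. tauto.
Qed.

Lemma df_mem t t' : tm t -> tm t' -> df (fun r => t r ∈ t' r).
Proof. apply (df_atom FMem); simpl; tauto. Qed.
Lemma df_eq t t' : tm t -> tm t' -> df (fun r => t r = t' r).
Proof. apply (df_atom FEq); simpl; tauto. Qed.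
End Df.

Lemma df_st b2 t : tm b2 t -> df false b2 (fun r => st (t r)).
Proof.
  intros [[i ->]|[c [Hc ->]]].
  - exists (FSt (2 * i)), (fun _ => s0). split; [discriminate|]. split.
    + intros; apply st_s0.
    + intro r. cbn [satd]. rewrite mix_even. tauto.
  - apply df_cst.
Qed.

Ltac tms := cbv beta; first
  [ apply tm_var | apply tm_s0 | assumption
  | lazymatch goal with
    | |- tm _ (fun r => ?t (fun i => r (@?f i))) => apply (tm_comp t f); assumption
    end
  | (apply tm_cst; first [discriminate | intros _; assumption | assumption]) ].
Definition dm (o : option (env -> D)) (r : env) (x : D) : Prop :=
  match o with None => True | Some t => x ∈ t r end.

Lemma df_satd b1 b2 p : (b1 = true -> internal p) -> forall o tau,
  (forall t, o = Some t -> tm b2 t) -> (forall i, tm b2 (tau i)) ->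
  df b1 b2 (fun r => satd mem st (dm o r) (fun i => tau i r) p).
Proof.
  induction p as [i j|i j|i| |p IHp q IHq|p IHp]; simpl; intros Hp o tau Ho Ht.
  - apply df_eq; auto.
  - apply df_mem; auto.
  - destruct b1; [destruct (Hp eq_refl)|]. apply df_st; auto.
  - apply df_cst.
  - apply df_imp; [apply IHp|apply IHq]; auto; intro; apply Hp; auto.
  - apply (df_all (fun r x => dm o r x ->
      satd mem st (dm o r) (ec x (fun i => tau i r)) p)).
    apply df_imp.
    + destruct o as [t|]; simpl; [|apply df_cst].
      pose proof (Ho t eq_refl). apply df_mem; tms.
    + set (o' := match o with None => None
                 | Some t => Some (fun r : env => t (fun i => r (S i))) end).
      set (tau' := ec (fun r : env => r 0) (fun i (r : env) => tau i (fun i => r (S i)))).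
      apply (df_ext (fun r => satd mem st (dm o' r) (fun i => tau' i r) p)).
      * intro r. unfold tau'. rewrite (ec_comp (fun t : env -> D => t r)).
        unfold o'. destruct o; apply iff_refl.
      * apply IHp; auto.
        -- unfold o'. destruct o as [t|]; [|discriminate]. intros t' E. injection E as <-.
           pose proof (Ho t eq_refl). tms.
        -- intros [|i]; simpl; [tms|]. pose proof (Ht i). tms.
Qed.

Lemma df_sat b1 b2 p tau : (b1 = true -> internal p) -> (forall i, tm b2 (tau i)) ->
  df b1 b2 (fun r => sat (fun i => tau i r) p).
Proof. intros. apply (df_satd b1 b2 p H None tau); auto. discriminate. Qed.

Lemma df_subst b1 b2 P tau : df b1 b2 P -> (forall i, tm b2 (tau i)) ->
  df b1 b2 (fun r => P (fun i => tau i r)).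
Proof.
  intros [p [r0 [H1 [H2 H3]]]] Ht.
  apply (df_ext (fun r => sat (fun i => mix tau (fun i _ => r0 i) i r) p)).
  - intro r. rewrite H3, (mix_comp (fun t : env -> D => t r)). apply iff_refl.
  - apply df_sat; auto. intro i. unfold mix. destruct (Nat.even i); auto. apply tm_cst; auto.
Qed.

Lemma df_use1 b1 b2 (R : D -> Prop) t :
  df b1 b2 (fun r => R (r 0)) -> tm b2 t -> df b1 b2 (fun r => R (t r)).
Proof. intros H Ht. exact (df_subst b1 b2 _ (fun _ => t) H (fun _ => Ht)). Qed.

Lemma df_use2 b1 b2 (R : D -> D -> Prop) t t' : df b1 b2 (fun r => R (r 0) (r 1)) ->
  tm b2 t -> tm b2 t' -> df b1 b2 (fun r => R (t r) (t' r)).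
Proof.
  intros H Ht Ht'. apply (df_subst b1 b2 _ (ec t (fun _ => t')) H). intros [|i]; auto.
Qed.

Ltac dfs := repeat (cbv beta; lazymatch goal with
  | |- df _ _ (fun r => forall x : D, @?P r x) => apply (df_all P)
  | |- df _ _ (fun r => exists x : D, @?P r x) => apply (df_ex P)
  | |- df _ _ (fun r => @?P r /\ @?Q r) => apply (df_and P Q)
  | |- df _ _ (fun r => @?P r \/ @?Q r) => apply (df_or P Q)
  | |- df _ _ (fun r => @?P r <-> @?Q r) => apply (df_iff P Q)
  | |- df _ _ (fun r => ~ @?P r) => apply (df_not P)
  | |- df _ _ (fun r => @?P r -> @?Q r) => apply (df_imp P Q)
  | |- df _ _ (fun r => @?t r ∈ @?t' r) => apply (df_mem t t')
  | |- df _ _ (fun r => @?t r = @?t' r) => apply (df_eq t t')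
  | |- df _ _ (fun r => False) => apply df_cst
  | |- df _ _ (fun r => True) => apply df_cst
  | |- tm _ _ => tms
  | |- df _ _ (fun r => ?R (@?t r) (@?t' r)) =>
      first [ solve [eauto with dfdb nocore]
            | apply (df_use2 _ _ R t t'); [assumption| |] ]
  | |- df _ _ (fun r => ?R (@?t r)) =>
      first [ solve [eauto with dfdb nocore]
            | apply (df_use1 _ _ R t); [assumption|] ]
  | |- df _ _ _ => solve [eauto with dfdb nocore]
  end).

Hint Extern 1 (tm _ _) => solve [tms] : dfdb.

Lemma df_Emp b1 b2 t : tm b2 t -> df b1 b2 (fun r => Emp (t r)).
Proof. intros. unfold Emp. dfs. Qed.
Lemma df_Suc b1 b2 t t' : tm b2 t -> tm b2 t' -> df b1 b2 (fun r => Suc (t r) (t' r)).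
Proof. intros. unfold Suc. dfs. Qed.
Hint Resolve df_Emp df_Suc : dfdb.
Lemma df_Ind b1 b2 t : tm b2 t -> df b1 b2 (fun r => Ind (t r)).
Proof. intros. unfold Ind. dfs. Qed.
Hint Resolve df_Ind : dfdb.
Lemma df_isNat b1 b2 t : tm b2 t -> df b1 b2 (fun r => isNat (t r)).
Proof. intros. unfold isNat. dfs. Qed.

Hint Resolve df_isNat : dfdb.
Lemma df_Op b1 b2 t t' t'' : tm b2 t -> tm b2 t' -> tm b2 t'' ->
  df b1 b2 (fun r => Op (t r) (t' r) (t'' r)).
Proof. intros. unfold Op. dfs. Qed.
Hint Resolve df_Op : dfdb.
Lemma df_App b1 b2 t t' t'' : tm b2 t -> tm b2 t' -> tm b2 t'' ->
  df b1 b2 (fun r => App (t r) (t' r) (t'' r)).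
Proof. intros. unfold App. dfs. Qed.
Hint Resolve df_App : dfdb.
Lemma df_Func b1 b2 t : tm b2 t -> df b1 b2 (fun r => Func (t r)).
Proof. intros. unfold Func. dfs. Qed.
Hint Resolve df_Func : dfdb.
Lemma df_FunNat b1 b2 t : tm b2 t -> df b1 b2 (fun r => FunNat (t r)).
Proof. intros. unfold FunNat. dfs. Qed.
Lemma df_Fin b1 b2 t : tm b2 t -> df b1 b2 (fun r => Fin (t r)).
Proof. intros. unfold Fin. dfs. Qed.
Hint Resolve df_FunNat df_Fin : dfdb.

Lemma df_unary b1 b2 (P : D -> Prop) : df b1 b2 (fun r => P (r 0)) ->
  exists p r, (b1 = true -> internal p) /\ (b2 = true -> forall i, st (r i)) /\
    forall x, P x <-> sat (ec x r) p.
Proof.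
  intros [p [r0 [H1 [H2 H3]]]].
  exists (ren (fun i => match i with 0 => 0 | S k => S (S k) end) p), (mix (fun _ => s0) r0).
  split; [|split].
  - intro. apply internal_ren; auto.
  - intros E i. unfold mix. destruct (Nat.even i); auto. apply st_s0.
  - intro x. rewrite satd_ren. rewrite (H3 (ec x (fun _ => s0))).
    replace (fun i => ec x (mix (fun _ => s0) r0) match i with 0 => 0 | S k => S (S k) end)
      with (mix (ec x (fun _ => s0)) r0); [apply iff_refl|].
    apply functional_extensionality; intros [|[|i]]; reflexivity.
Qed.

Lemma df_binary b1 b2 (P : D -> D -> Prop) : df b1 b2 (fun r => P (r 0) (r 1)) ->
  exists p r, (b1 = true -> internal p) /\ (b2 = true -> forall i, st (r i)) /\
    forall x y, P x y <-> sat (ec x (ec y r)) p.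
Proof.
  intros [p [r0 [H1 [H2 H3]]]].
  exists (ren (fun i => match i with 0 => 0 | 2 => 1 | k => S (S k) end) p),
    (mix (fun _ => s0) r0).
  split; [|split].
  - intro. apply internal_ren; auto.
  - intros E i. unfold mix. destruct (Nat.even i); auto. apply st_s0.
  - intros x y. rewrite satd_ren. rewrite (H3 (ec x (ec y (fun _ => s0)))).
    match goal with |- satd _ _ _ ?a _ <-> satd _ _ _ ?b _ => replace b with a end;
      [apply iff_refl|].
    apply functional_extensionality; intros [|[|[|[|i]]]]; reflexivity.
Qed.

(** * The axioms, read semantically *)

Lemma extensionality x y : (forall z, z ∈ x <-> z ∈ y) -> x = y.
Proof.
  assert (H : sat (fun _ => s0) ax_ext <->
    forall x y, (forall z, z ∈ x <-> z ∈ y) -> x = y) by (unfold ax_ext; sem).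
  apply H, HN, IExt.
Qed.
Lemma foundation x : (exists y, y ∈ x) -> exists y, y ∈ x /\ ~ exists z, z ∈ y /\ z ∈ x.
Proof.
  assert (H : sat (fun _ => s0) ax_found <-> forall x,
    (exists y, y ∈ x) -> exists y, y ∈ x /\ ~ exists z, z ∈ y /\ z ∈ x)
    by (unfold ax_found; sem).
  apply H, HN, IFound.
Qed.
Lemma pairing x y : exists z, x ∈ z /\ y ∈ z.
Proof.
  assert (H : sat (fun _ => s0) ax_pair <-> forall x y, exists z, x ∈ z /\ y ∈ z)
    by (unfold ax_pair; sem).
  apply H, HN, IPair.
Qed.
Lemma unions F : exists A, forall Y x, x ∈ Y /\ Y ∈ F -> x ∈ A.
Proof.
  assert (H : sat (fun _ => s0) ax_union <->
    forall F, exists A, forall Y x, x ∈ Y /\ Y ∈ F -> x ∈ A) by (unfold ax_union; sem).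
  apply H, HN, IUnion.
Qed.
Lemma infinity : exists I, Ind I.
Proof.
  assert (H : sat (fun _ => s0) ax_inf <-> exists I, Ind I) by (unfold ax_inf; semu).
  apply H, HN, IInf.
Qed.
Lemma powerset x : exists y, forall z, (forall w, w ∈ z -> w ∈ x) -> z ∈ y.
Proof.
  assert (H : sat (fun _ => s0) ax_pow <->
    forall x, exists y, forall z, (forall w, w ∈ z -> w ∈ x) -> z ∈ y) by (unfold ax_pow; sem).
  apply H, HN, IPow.
Qed.
Lemma choice X :
  (forall x, x ∈ X -> exists w, w ∈ x) /\
  (forall x y, x ∈ X /\ y ∈ X /\ ~ x = y -> ~ exists w, w ∈ x /\ w ∈ y) ->
  exists C, forall x, x ∈ X ->
    exists c, c ∈ x /\ c ∈ C /\ forall c', c' ∈ x /\ c' ∈ C -> c' = c.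
Proof.
  assert (H : sat (fun _ => s0) ax_choice <-> forall X,
    (forall x, x ∈ X -> exists w, w ∈ x) /\
    (forall x y, x ∈ X /\ y ∈ X /\ ~ x = y -> ~ exists w, w ∈ x /\ w ∈ y) ->
    exists C, forall x, x ∈ X ->
      exists c, c ∈ x /\ c ∈ C /\ forall c', c' ∈ x /\ c' ∈ C -> c' = c)
    by (unfold ax_choice; sem).
  apply H, HN, IChoice.
Qed.

Ltac embs := unfold emb; rewrite ?satd_ren;
  match goal with |- satd _ _ _ ?a _ <-> satd _ _ _ ?b _ => replace a with b end;
  [apply iff_refl|
   apply functional_extensionality; intros [|[|i]]; simpl; rewrite ?Nat.sub_0_r; reflexivity].

Lemma separation (P : D -> Prop) : df true false (fun r => P (r 0)) ->
  forall x, exists y, forall z, z ∈ y <-> z ∈ x /\ P z.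
Proof.
  intros HP. destruct (df_unary _ _ _ HP) as [p [r [H1 [_ H2]]]].
  (* The axiom hands both [z] and [x] to its formula; the renaming skips the place of [x]. *)
  set (q := ren (fun i => match i with 0 => 0 | S k => S (S k) end) p).
  assert (H : sat r (ax_sep q) <->
    forall x, exists y, forall z, z ∈ y <-> z ∈ x /\ P z).
  { unfold ax_sep; sem. rewrite H2. unfold q. embs. }
  apply H, HN, ISep. apply internal_ren; auto.
Qed.

Lemma replacement (P : D -> D -> Prop) : df true false (fun r => P (r 0) (r 1)) ->
  forall A, (forall x, x ∈ A -> exists y, P x y /\ forall y', P x y' -> y = y') ->
  exists B, forall x, x ∈ A -> exists y, y ∈ B /\ P x y.
Proof.
  intros HP. destruct (df_binary _ _ _ HP) as [p [r [H1 [_ H2]]]].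
  set (q := ren (fun i => match i with 0 => 0 | 1 => 1 | S k => S (S k) end) p).
  assert (H : sat r (ax_repl q) <->
    forall A, (forall x, x ∈ A -> exists y, P x y /\ forall y', P x y' -> y = y') ->
    exists B, forall x, x ∈ A -> exists y, y ∈ B /\ P x y).
  { unfold ax_repl; sem; rewrite H2; unfold q; embs. }
  apply H, HN, IRepl. apply internal_ren; auto.
Qed.

Lemma idealization (P : D -> D -> Prop) : df true false (fun r => P (r 0) (r 1)) ->
  ((forall A, st A /\ Fin A -> exists x, forall a, a ∈ A -> P x a) <->
   exists x, forall a, st a -> P x a).
Proof.
  intros HP. destruct (df_binary _ _ _ HP) as [p [r [H1 [_ H2]]]].
  assert (H : sat r (ax_ideal p) <->
    ((forall A, st A /\ Fin A -> exists x, forall a, a ∈ A -> P x a) <->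
   exists x, forall a, st a -> P x a)).
  { unfold ax_ideal; sem; try (rewrite H2; embs). apply sat_Fin. }
  apply H, HN, IIdeal. auto.
Qed.

Lemma standardization (P : D -> Prop) : df false false (fun r => P (r 0)) ->
  forall X, st X -> exists Y, st Y /\ forall x, st x -> (x ∈ Y <-> x ∈ X /\ P x).
Proof.
  intros HP. destruct (df_unary _ _ _ HP) as [p [r [_ [_ H2]]]].
  assert (H : sat r (ax_stand p) <->
    forall X, st X -> exists Y, st Y /\ forall x, st x -> (x ∈ Y <-> x ∈ X /\ P x)).
  { unfold ax_stand; sem; rewrite H2; embs. }
  apply H, HN, IStand.
Qed.

Lemma transfer (P : D -> Prop) : df true true (fun r => P (r 0)) ->
  (exists x, P x) -> exists x, st x /\ P x.
Proof.
  intros HP [x Hx]. destruct (df_unary _ _ _ HP) as [p [r [H1 [H2 H3]]]].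
  destruct (transfer_form p r) as [y [Hy1 Hy2]]; auto.
  - exists x. apply H3, Hx.
  - exists y. split; auto. apply H3, Hy2.
Qed.

Lemma transfer_all (P : D -> Prop) : df true true (fun r => P (r 0)) ->
  (forall x, st x -> P x) -> forall x, P x.
Proof.
  intros HP H x. apply NNPP. intro N.
  destruct (transfer (fun x => ~ P x)) as [y [Hy Ny]]; eauto.
  apply (df_not (fun r => P (r 0))). exact HP.
Qed.

(** * Elementary set theory *)

Definition sub x y := forall z, z ∈ x -> z ∈ y.
Lemma df_sub b1 b2 t t' : tm b2 t -> tm b2 t' -> df b1 b2 (fun r => sub (t r) (t' r)).
Proof. intros. unfold sub. dfs. Qed.
Hint Resolve df_sub : dfdb.

Lemma sub_antisym x y : sub x y -> sub y x -> x = y.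
Proof. intros H K. apply extensionality. intro z. split; auto. Qed.

Lemma upair_ex a b : exists p, forall z, z ∈ p <-> z = a \/ z = b.
Proof.
  destruct (pairing a b) as [q [Ha Hb]].
  destruct (separation (fun z => z = a \/ z = b)) with (x := q) as [p Hp]; [dfs|].
  exists p. intro z. rewrite Hp. split; [tauto|]. intros [->| ->]; auto.
Qed.

Lemma union_ex F : exists u, forall z, z ∈ u <-> exists Y, Y ∈ F /\ z ∈ Y.
Proof.
  destruct (unions F) as [A HA].
  destruct (separation (fun z => exists Y, Y ∈ F /\ z ∈ Y)) with (x := A) as [p Hp]; [dfs|].
  exists p. intro z. rewrite Hp. split; [tauto|]. intros [Y HY]. split; eauto.
  apply (HA Y); tauto.
Qed.

Lemma power_ex x : exists p, forall z, z ∈ p <-> sub z x.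
Proof.
  destruct (powerset x) as [A HA].
  destruct (separation (fun z => sub z x)) with (x := A) as [p Hp]; [dfs|].
  exists p. intro z. rewrite Hp. split; [tauto|]. auto.
Qed.

Lemma cup_ex x y : exists u, forall z, z ∈ u <-> z ∈ x \/ z ∈ y.
Proof.
  destruct (upair_ex x y) as [p Hp]. destruct (union_ex p) as [u Hu].
  exists u. intro z. rewrite Hu. split.
  - intros [Y [H1 H2]]. apply Hp in H1. destruct H1; subst; auto.
  - intros [H|H]; [exists x|exists y]; rewrite Hp; auto.
Qed.

Lemma adjoin_ex x a : exists u, forall z, z ∈ u <-> z ∈ x \/ z = a.
Proof.
  destruct (upair_ex a a) as [p Hp]. destruct (cup_ex x p) as [u Hu].
  exists u. intro z. rewrite Hu, Hp. tauto.
Qed.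

Lemma empty_ex : exists e, Emp e.
Proof.
  destruct (separation (fun _ => False)) with (x := s0) as [e He]; [dfs|].
  exists e. intros z Hz. apply He in Hz. tauto.
Qed.

Lemma Emp_unique e e' : Emp e -> Emp e' -> e = e'.
Proof.
  intros H K. apply extensionality. intro z. split; intro Z; exfalso; [apply (H z)|apply (K z)]; auto.
Qed.

Lemma no_cycle x y : x ∈ y -> y ∈ x -> False.
Proof.
  intros H K. destruct (upair_ex x y) as [p Hp]. destruct (foundation p) as [z [Hz N]].
  - exists x. apply Hp. auto.
  - apply N. apply Hp in Hz. destruct Hz as [->| ->].
    + exists y. rewrite Hp. auto.
    + exists x. rewrite Hp. auto.
Qed.

Lemma no_loop x : x ∉ x.
Proof. intro H. exact (no_cycle x x H H). Qed.

Lemma image_ex (P : D -> D -> Prop) A : df true false (fun r => P (r 0) (r 1)) ->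
  (forall x y y', x ∈ A -> P x y -> P x y' -> y = y') ->
  exists B, forall y, y ∈ B <-> exists x, x ∈ A /\ P x y.
Proof.
  intros HP F.
  destruct (separation (fun x => exists y, P x y)) with (x := A) as [A' HA']; [dfs|].
  destruct (replacement P HP A') as [B HB].
  - intros x Hx. apply HA' in Hx. destruct Hx as [Hx [y Hy]]. exists y. split; eauto.
  - destruct (separation (fun y => exists x, x ∈ A /\ P x y)) with (x := B) as [B' HB']; [dfs|].
    exists B'. intro y. rewrite HB'. split; [tauto|]. intros [x [Hx Hy]]. split; eauto.
    destruct (HB x) as [y' [Hy1 Hy2]].
    + apply HA'. eauto.
    + rewrite (F x y y'); auto.
Qed.

Lemma Op_ex a b : exists p, Op a b p.
Proof.
  destruct (upair_ex a a) as [x Hx]. destruct (upair_ex a b) as [y Hy].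
  destruct (upair_ex x y) as [p Hp]. exists p. intro z. rewrite Hp. split.
  - intros [->| ->]; [left|right]; intro w; [rewrite Hx|rewrite Hy]; tauto.
  - intros [H|H]; [left|right]; apply extensionality; intro w;
      [rewrite Hx, H|rewrite Hy, H]; tauto.
Qed.

Lemma Op_unique a b p p' : Op a b p -> Op a b p' -> p = p'.
Proof. intros H K. apply extensionality. intro z. rewrite (H z), (K z). tauto. Qed.

Lemma Op_inj a b a' b' p : Op a b p -> Op a' b' p -> a = a' /\ b = b'.
Proof.
  intros H K.
  assert (L : forall a b a' b', Op a b p -> Op a' b' p -> a = a' /\ (b = b' \/ b = a)).
  { clear a b a' b' H K. intros a b a' b' H K.
    destruct (upair_ex a a) as [x Hx]. destruct (upair_ex a b) as [y Hy].
    assert (X : x ∈ p) by (apply H; left; intro w; rewrite Hx; tauto).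
    assert (Y : y ∈ p) by (apply H; right; intro w; rewrite Hy; tauto).
    assert (E : a = a').
    { apply K in X. destruct X as [X|X]; symmetry; destruct (Hx a') as [H1 _];
        (destruct H1; [apply X; auto|auto|auto]). }
    split; auto. subst a'. apply K in Y.
    assert (B : b ∈ y) by (apply Hy; auto).
    destruct Y as [Y|Y]; apply Y in B; tauto. }
  destruct (L _ _ _ _ H K) as [<- [E|E]]; auto.
  destruct (L _ _ _ _ K H) as [_ [E'|E']]; subst; auto.
Qed.

Lemma App_Op f a b p : Op a b p -> (App f a b <-> p ∈ f).
Proof.
  intro H. split.
  - intros [q [Hq K]]. rewrite (Op_unique _ _ _ _ H K). exact Hq.
  - intro K. exists p. auto.
Qed.

Lemma relation_ex (P : D -> D -> Prop) U V : df true false (fun r => P (r 0) (r 1)) ->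
  exists h, (forall p, p ∈ h -> exists a b, Op a b p /\ a ∈ U /\ b ∈ V) /\
    forall a b, App h a b <-> a ∈ U /\ b ∈ V /\ P a b.
Proof.
  intro HP. destruct (cup_ex U V) as [W HW]. destruct (power_ex W) as [W1 HW1].
  destruct (power_ex W1) as [W2 HW2].
  destruct (separation (fun p => exists a b, Op a b p /\ a ∈ U /\ b ∈ V /\ P a b))
    with (x := W2) as [h Hh]; [dfs|].
  exists h. split.
  - intros p Hp. apply Hh in Hp. destruct Hp as [_ [a [b H]]]. exists a, b. tauto.
  - intros a b. destruct (Op_ex a b) as [p Hp]. rewrite (App_Op h a b p Hp), Hh. split.
    + intros [_ [a' [b' [H K]]]]. destruct (Op_inj _ _ _ _ _ Hp H) as [<- <-]. exact K.
    + intro K. split; [|exists a, b; auto]. apply HW2. intros z Hz. apply HW1.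
      intros w Hw. apply HW. apply Hp in Hz.
      destruct Hz as [Hz|Hz]; apply Hz in Hw.
      * subst; tauto.
      * destruct Hw; subst; tauto.
Qed.

Lemma Suc_ex n : exists s, Suc n s.
Proof. destruct (adjoin_ex n n) as [s Hs]. exists s. exact Hs. Qed.
Lemma Suc_unique n s s' : Suc n s -> Suc n s' -> s = s'.
Proof. intros H K. apply extensionality. intro z. rewrite (H z), (K z). tauto. Qed.
Lemma Suc_inj n m s : Suc n s -> Suc m s -> n = m.
Proof.
  intros H K. assert (A : n ∈ s) by (apply H; auto). assert (B : m ∈ s) by (apply K; auto).
  apply K in A. apply H in B. destruct A as [A|A], B as [B|B]; auto.
  destruct (no_cycle n m A B).
Qed.
Lemma Suc_nonempty n s : Suc n s -> ~ Emp s.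
Proof. intros H E. apply (E n). apply H. auto. Qed.

Lemma Nat_Emp e : Emp e -> isNat e.
Proof. intros H I [[e' [K1 K2]] _]. rewrite (Emp_unique e e'); auto. Qed.
Lemma Nat_Suc n s : isNat n -> Suc n s -> isNat s.
Proof.
  intros H K I HI. destruct (proj2 HI n (H I HI)) as [s' [K1 K2]].
  rewrite (Suc_unique n s s'); auto.
Qed.

Lemma nat_ind_def (P : D -> Prop) : df true false (fun r => P (r 0)) ->
  (forall e, Emp e -> P e) -> (forall n s, isNat n -> P n -> Suc n s -> P s) ->
  forall n, isNat n -> P n.
Proof.
  intros HP H0 HS n Hn. destruct infinity as [I HI].
  destruct (separation (fun z => isNat z /\ P z)) with (x := I) as [J HJ]; [dfs|].
  apply (HJ n), Hn. split.
  - destruct HI as [[e [E1 E2]] _]. exists e. rewrite HJ.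
    repeat split; auto. apply Nat_Emp; auto.
  - intros y Hy. apply HJ in Hy. destruct Hy as [Y1 [Y2 Y3]].
    destruct (proj2 HI y Y1) as [s [S1 S2]]. exists s. split; auto. apply HJ. split; auto. split; [eapply Nat_Suc; eauto|eauto].
Qed.

Lemma omega_ex : exists w, forall n, n ∈ w <-> isNat n.
Proof.
  destruct infinity as [I HI].
  destruct (separation isNat) with (x := I) as [w Hw]; [dfs|].
  exists w. intro n. rewrite Hw. split; [tauto|]. auto.
Qed.

Lemma recursion (G : D -> D -> Prop) a : df true false (fun r => G (r 0) (r 1)) ->
  (forall x, exists y, G x y) -> (forall x y y', G x y -> G x y' -> y = y') ->
  exists g, FunNat g /\ (forall e x, Emp e -> App g e x -> x = a) /\
    forall n s x y, Suc n s -> App g n x -> App g s y -> G x y.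
Proof.
  intros HG GE GU.
  (* An attempt [f] need not be functional: each of its pairs is the initial one or is justified by
     a pair of [f] at the predecessor. Uniqueness of values is proved afterwards, by induction,
     across all attempts. *)
  set (Q := fun f => forall m y, App f m y -> (Emp m /\ y = a) \/
    exists m' y', Suc m' m /\ App f m' y' /\ G y' y).
  set (R := fun n x => exists f, App f n x /\ Q f).
  assert (dR : df true false (fun r => R (r 0) (r 1))) by (unfold R, Q; dfs).
  assert (RE : forall n, isNat n -> exists x, R n x).
  { apply nat_ind_def; [dfs| |].
    - intros e He. destruct (Op_ex e a) as [p Hp]. destruct (upair_ex p p) as [f Hf].
      exists a, f. split.
      + apply (App_Op f e a p Hp), Hf. auto.
      + intros m y [q [Hq K]]. apply Hf in Hq.
        assert (q = p) by tauto. subst q.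
        destruct (Op_inj _ _ _ _ _ Hp K) as [<- <-]. auto.
    - intros n s Hn [x [f [H1 H2]]] Hs. destruct (GE x) as [y Hy].
      destruct (Op_ex s y) as [p Hp]. destruct (adjoin_ex f p) as [f' Hf].
      assert (Hsub : forall m z, App f m z -> App f' m z).
      { intros m z [q [Hq K]]. exists q. rewrite Hf. auto. }
      exists y, f'. split.
      + apply (App_Op f' s y p Hp), Hf. auto.
      + intros m z [q [Hq K]]. apply Hf in Hq. destruct Hq as [Hq| ->].
        * destruct (H2 m z) as [E|[m' [y' [E1 [E2 E3]]]]].
          -- exists q. auto.
          -- auto.
          -- right. exists m', y'. auto.
        * destruct (Op_inj _ _ _ _ _ Hp K) as [<- <-]. right. exists n, x. auto. }
  assert (RU : forall n, isNat n -> forall x x', R n x -> R n x' -> x = x').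
  { apply (nat_ind_def (fun n => forall x x', R n x -> R n x' -> x = x')); [dfs| |].
    - intros e He x x' [f [H1 H2]] [f' [K1 K2]].
      destruct (H2 _ _ H1) as [[_ ->]|[m [_ [M _]]]]; [|destruct (Suc_nonempty _ _ M He)].
      destruct (K2 _ _ K1) as [[_ ->]|[m [_ [M _]]]]; auto. destruct (Suc_nonempty _ _ M He).
    - intros n s Hn IH Hs x x' [f [H1 H2]] [f' [K1 K2]].
      destruct (H2 _ _ H1) as [[E _]|[m [y [M [A1 A2]]]]]; [destruct (Suc_nonempty _ _ Hs E)|].
      destruct (K2 _ _ K1) as [[E _]|[m' [y' [M' [A1' A2']]]]];
        [destruct (Suc_nonempty _ _ Hs E)|].
      rewrite (Suc_inj _ _ _ M Hs) in A1. rewrite (Suc_inj _ _ _ M' Hs) in A1'.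
      rewrite (IH y' y) in A2'; [eauto| |]; eexists; eauto. }
  destruct omega_ex as [w Hw].
  destruct (image_ex R w dR) as [B HB].
  { intros x y y' Hx. apply RU, Hw, Hx. }
  destruct (relation_ex R w B dR) as [g [Hg1 Hg2]].
  assert (GR : forall n x, App g n x <-> isNat n /\ R n x).
  { intros n x. rewrite Hg2, Hw, HB. split; [tauto|]. intros [H K]. repeat split; auto.
    exists n. rewrite Hw. auto. }
  exists g. split; [|split].
  - split; [split|].
    + intros p Hp. destruct (Hg1 p Hp) as [x [y [H _]]]. eauto.
    + intros x y y' [H K]. apply GR in H. apply GR in K.
      apply (RU x); tauto.
    + intro n. split.
      * intros [b Hb]. apply GR in Hb. tauto.
      * intro Hn. destruct (RE n Hn) as [x Hx]. exists x. apply GR. auto.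
  - intros e x He H. apply GR in H. destruct H as [_ [f [H1 H2]]].
    destruct (H2 _ _ H1) as [[_ ->]|[m [y [M _]]]]; auto. destruct (Suc_nonempty _ _ M He).
  - intros n s x y Hs Hx Hy. apply GR in Hx. apply GR in Hy.
    destruct Hy as [_ [f [H1 H2]]].
    destruct (H2 _ _ H1) as [[E _]|[m [y' [M [A1 A2]]]]]; [destruct (Suc_nonempty _ _ Hs E)|].
    rewrite (Suc_inj _ _ _ M Hs) in A1.
    rewrite (RU n (proj1 Hx) x y'); [exact A2|tauto|]. exists f. auto.
Qed.

Lemma range_union_ex g : FunNat g ->
  exists T, forall z, z ∈ T <-> exists n v, App g n v /\ z ∈ v.
Proof.
  intros [[_ Hf] Hd]. destruct omega_ex as [w Hw].
  destruct (image_ex (App g) w) as [B HB]; [dfs|eauto|].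
  destruct (union_ex B) as [T HT]. exists T. intro z. rewrite HT. split.
  - intros [v [Hv Hz]]. apply HB in Hv. destruct Hv as [n [_ Hn]]. eauto.
  - intros [n [v [Hn Hz]]]. exists v. split; auto. apply HB. exists n. rewrite Hw, <- Hd. eauto.
Qed.

Lemma transitive_superset x : exists T, x ∈ T /\ forall z w, z ∈ T -> w ∈ z -> w ∈ T.
Proof.
  destruct (upair_ex x x) as [a Ha].
  destruct (recursion (fun x y => forall z, z ∈ y <-> exists Y, Y ∈ x /\ z ∈ Y) a)
    as [g [G1 [G2 G3]]].
  - dfs.
  - apply union_ex.
  - intros u y y' H K. apply extensionality. intro z. rewrite H, K. tauto.
  - destruct (range_union_ex g G1) as [T HT]. exists T. split.
    + destruct empty_ex as [e He]. destruct (proj2 G1 e) as [_ K].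
      destruct (K (Nat_Emp e He)) as [b Hb]. apply HT. exists e, b. split; auto.
      rewrite (G2 e b He Hb). apply Ha. auto.
    + intros z w Hz Hw. apply HT in Hz. destruct Hz as [n [v [Hv Hz]]].
      destruct (Suc_ex n) as [s Hs].
      assert (Hn : isNat n) by (apply (proj2 G1); eauto).
      destruct (proj2 G1 s) as [_ K].
      destruct (K (Nat_Suc n s Hn Hs)) as [b Hb]. apply HT. exists s, b. split; auto.
      apply (G3 n s v b Hs Hv Hb). eauto.
Qed.

Lemma eps_ind (P : D -> Prop) : df true false (fun r => P (r 0)) ->
  (forall x, (forall y, y ∈ x -> P y) -> P x) -> forall x, P x.
Proof.
  intros HP H x. apply NNPP. intro N. destruct (transitive_superset x) as [T [HT1 HT2]].
  destruct (separation (fun z => ~ P z)) with (x := T) as [S HS]; [dfs|].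
  destruct (foundation S) as [y [Hy NY]].
  - exists x. apply HS. auto.
  - apply HS in Hy. apply (proj2 Hy), H. intros z Hz. apply NNPP. intro NZ.
    apply NY. exists z. split; auto. apply HS. split; auto. apply (HT2 y); tauto.
Qed.

(** * Levels of the cumulative hierarchy *)

(** Levels are introduced without ordinals, following Button's level theory:
    a tower is a set in which every [X] is the union of the power sets of the
    members of the tower that belong to [X]. *)
Definition tower T := forall X, X ∈ T ->
  forall x, x ∈ X <-> exists Y, Y ∈ T /\ Y ∈ X /\ sub x Y.
Definition level L := exists T, tower T /\ forall x, x ∈ L <-> exists Y, Y ∈ T /\ sub x Y.

Lemma df_level b1 b2 t : tm b2 t -> df b1 b2 (fun r => level (t r)).
Proof. intros. unfold level, tower. dfs. Qed.
Hint Resolve df_level : dfdb.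

Lemma tower_trans T : tower T -> forall X, X ∈ T -> forall x z, x ∈ X -> z ∈ x -> z ∈ X.
Proof.
  intros HT. apply (eps_ind (fun X => X ∈ T -> forall x z, x ∈ X -> z ∈ x -> z ∈ X)); [dfs|].
  intros X IH HX x z Hx Hz. apply (HT X HX) in Hx. destruct Hx as [Y [Y1 [Y2 Y3]]].
  apply (HT X HX). exists Y. repeat split; auto. intros w Hw. apply (IH Y Y2 Y1 z); auto.
Qed.

Lemma tower_level T X : tower T -> X ∈ T -> level X.
Proof.
  intros HT HX.
  destruct (separation (fun Y => Y ∈ X)) with (x := T) as [T' HT']; [dfs|].
  exists T'. split.
  - intros Z HZ x. apply HT' in HZ. rewrite (HT Z (proj1 HZ)). split.
    + intros [Y [Y1 [Y2 Y3]]]. exists Y. rewrite HT'. repeat split; auto.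
      apply (tower_trans T HT X HX Z); tauto.
    + intros [Y [Y1 Y2]]. apply HT' in Y1. exists Y. tauto.
  - intro x. rewrite (HT X HX). split; intros [Y HY]; exists Y.
    + rewrite HT'. tauto.
    + rewrite HT' in HY. tauto.
Qed.

Lemma level_super L x y : level L -> x ∈ L -> sub y x -> y ∈ L.
Proof.
  intros [T [_ H]] Hx Hy. apply H in Hx. destruct Hx as [Y [Y1 Y2]].
  apply H. exists Y. split; auto. intros z Hz. auto.
Qed.

Lemma level_acc L x : level L -> x ∈ L -> exists K, level K /\ K ∈ L /\ sub x K.
Proof.
  intros [T [HT H]] Hx. apply H in Hx. destruct Hx as [Y [Y1 Y2]]. exists Y.
  split; [apply (tower_level T); auto|]. split; auto. apply H. exists Y. split; auto.
  intros z Hz; auto.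
Qed.

Lemma level_trans L x z : level L -> x ∈ L -> z ∈ x -> z ∈ L.
Proof.
  intros [T [HT H]] Hx Hz. apply H in Hx. destruct Hx as [Y [Y1 Y2]].
  apply H. exists Y. split; auto. intros w Hw. apply (tower_trans T HT Y Y1 z); auto.
Qed.

(** Double ∈-induction, as for ordinals: if neither level belongs to the other, each element of one
    is included in a smaller level, and the induction hypothesis places that level in the other. *)
Lemma level_linear K : level K -> forall L, level L -> K ∈ L \/ K = L \/ L ∈ K.
Proof.
  revert K. apply (eps_ind (fun K => level K -> forall L, level L -> K ∈ L \/ K = L \/ L ∈ K)).
  { dfs. }
  intros K IHK HK.
  apply (eps_ind (fun L => level L -> K ∈ L \/ K = L \/ L ∈ K)); [dfs|].
  intros L IHL HL.
  destruct (classic (K ∈ L)) as [|N1]; auto. destruct (classic (L ∈ K)) as [|N2]; auto.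
  right; left. apply sub_antisym; intros x Hx.
  - destruct (level_acc K x HK Hx) as [K' [A1 [A2 A3]]].
    destruct (IHK K' A2 A1 L HL) as [E|[E|E]].
    + apply (level_super L K'); auto.
    + subst. tauto.
    + destruct N2. apply (level_trans K K'); auto.
  - destruct (level_acc L x HL Hx) as [L' [A1 [A2 A3]]].
    destruct (IHL L' A2 A1) as [E|[E|E]].
    + destruct N1. apply (level_trans L L'); auto.
    + subst. tauto.
    + apply (level_super K L'); auto.
Qed.

Lemma level_mem_sub K L : level L -> K ∈ L -> sub K L.
Proof. intros HL H z Hz. apply (level_trans L K); auto. Qed.

Lemma level_total K L : level K -> level L -> sub K L \/ sub L K.
Proof.
  intros HK HL. destruct (level_linear K HK L HL) as [E|[->|E]].
  - left. apply level_mem_sub; auto.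
  - left. intros z; auto.
  - right. apply level_mem_sub; auto.
Qed.

Lemma level_least (P : D -> Prop) : df true false (fun r => P (r 0)) ->
  (exists L, level L /\ P L) ->
  exists L, level L /\ P L /\ forall L', level L' -> P L' -> sub L L'.
Proof.
  intros HP [L0 HL0]. apply NNPP. intro N.
  apply (eps_ind (fun L => ~ (level L /\ P L))) with (x := L0); auto; [dfs|].
  intros L IH [H1 H2]. apply N. exists L. split; auto. split; auto.
  intros L' K1 K2. destruct (level_linear L H1 L' K1) as [E|[->|E]].
  - apply level_mem_sub; auto.
  - intros z; auto.
  - destruct (IH L' E). auto.
Qed.

Lemma tower_of_closed T : (forall X, X ∈ T -> level X) ->
  (forall X Y, X ∈ T -> level Y -> Y ∈ X -> Y ∈ T) -> tower T.
Proof.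
  intros H1 H2 X HX x. split.
  - intro Hx. destruct (level_acc X x (H1 X HX) Hx) as [K [A1 [A2 A3]]]. exists K.
    split; [apply (H2 X)|]; auto.
  - intros [Y [Y1 [Y2 Y3]]]. apply (level_super X Y); auto.
Qed.

(** Closing [S] downwards under levels gives a tower; the union of the power sets of its members is
    the level sought. *)
Lemma level_above S : (forall K, K ∈ S -> level K) ->
  exists L, level L /\ forall K, K ∈ S -> K ∈ L.
Proof.
  intro HS. destruct (union_ex S) as [U HU]. destruct (cup_ex U S) as [Z HZ].
  destruct (separation level) with (x := Z) as [T HT]; [dfs|].
  destruct (union_ex T) as [W HW]. destruct (power_ex W) as [V HV].
  destruct (separation (fun x => exists Y, Y ∈ T /\ sub x Y)) with (x := V) as [L HL]; [dfs|].
  exists L. split.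
  - exists T. split.
    + apply tower_of_closed.
      * intros X HX. apply HT in HX. tauto.
      * intros X Y HX HY1 HY2. apply HT. split; auto. apply HZ. left. apply HU.
        apply HT in HX. destruct HX as [HX _]. apply HZ in HX. destruct HX as [HX|HX].
        -- apply HU in HX. destruct HX as [K [K1 K2]]. exists K. split; auto.
           apply (level_trans K X); auto.
        -- eauto.
    + intro x. rewrite HL. split; [tauto|]. intros [Y [Y1 Y2]]. split; eauto.
      apply HV. intros z Hz. apply HW. eauto.
  - intros K HK. apply HL.
    assert (KT : K ∈ T) by (apply HT; rewrite HZ; auto).
    split.
    + apply HV. intros z Hz. apply HW. eauto.
    + exists K. split; auto. intros z; auto.
Qed.

Lemma level_next L : level L -> exists L', level L' /\ L ∈ L'.
Proof.
  intro H. destruct (upair_ex L L) as [S HS]. destruct (level_above S) as [L' [A B]].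
  - intros K HK. apply HS in HK. destruct HK; subst; auto.
  - exists L'. split; auto. apply B, HS. auto.
Qed.

(** Scott's trick: the least level for [y] is unique, so Replacement collects these levels, and
    monotonicity carries the property to a level above them all. *)
Lemma collection_least (R : D -> D -> Prop) A : df true false (fun r => R (r 0) (r 1)) ->
  (forall y, y ∈ A -> exists L, level L /\ R y L) ->
  (forall y L L', R y L -> level L' -> sub L L' -> R y L') ->
  exists L, level L /\ forall y, y ∈ A -> R y L.
Proof.
  intros HR H M.
  destruct (image_ex (fun y L => level L /\ R y L /\
    forall L', level L' -> R y L' -> sub L L') A) as [S HS].
  - dfs.
  - intros y L L' _ [H1 [H2 H3]] [K1 [K2 K3]]. apply sub_antisym; auto.
  - destruct (level_above S) as [L [HL1 HL2]].
    + intros K HK. apply HS in HK. destruct HK as [y HK]. tauto.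
    + exists L. split; auto. intros y Hy.
      destruct (level_least (R y)) as [K [K1 [K2 K3]]]; [dfs|auto|].
      apply (M y K); auto. apply level_mem_sub; auto. apply HL2, HS. exists y. auto.
Qed.

Lemma in_level x : exists L, level L /\ x ∈ L.
Proof.
  revert x. apply (eps_ind (fun x => exists L, level L /\ x ∈ L)); [dfs|].
  intros x IH. destruct (collection_least (fun y L => y ∈ L) x) as [L [H1 H2]]; auto.
  - dfs.
  - destruct (level_next L H1) as [L' [A B]]. exists L'. split; auto.
    apply (level_super L' L); auto.
Qed.

Lemma level_of_union M :
  (forall z, z ∈ M -> exists K, level K /\ K ∈ M /\ z ∈ K /\ sub K M) -> level M.
Proof.
  intro H. destruct (separation level) with (x := M) as [T HT]; [dfs|].
  exists T. split.
  - apply tower_of_closed.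
    + intros X HX. apply HT in HX. tauto.
    + intros X Y HX HY1 HY2. apply HT. split; auto. apply HT in HX.
      destruct (H X (proj1 HX)) as [K [A1 [A2 [A3 A4]]]]. apply A4.
      apply (level_trans K X); auto.
  - intro x. split.
    + intro Hx. destruct (H x Hx) as [K [A1 [A2 [A3 A4]]]]. exists K. rewrite HT.
      split; auto. apply level_mem_sub; auto.
    + intros [Y [Y1 Y2]]. apply HT in Y1. destruct (H Y (proj1 Y1)) as [K [A1 [A2 [A3 A4]]]].
      apply A4. apply (level_super K Y); auto.
Qed.

(** * Reflection *)

(** Environments are not elements of the model, so quantification over them is replaced by [n]
    nested quantifiers over [K], with [s0] in all further places. *)
Fixpoint allK (n : nat) (K : D) (P : env -> Prop) : Prop :=
  match n with
  | 0 => P (fun _ => s0)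
  | S n => forall y, y ∈ K -> allK n K (fun r => P (ec y r))
  end.

Lemma allK_mono n K : forall P Q : env -> Prop, (forall r, P r -> Q r) ->
  allK n K P -> allK n K Q.
Proof.
  induction n as [|n IH]; simpl; intros P Q H; auto.
  intros HP y Hy. apply (IH (fun r => P (ec y r))); auto.
Qed.

Lemma allK_anti n K K' : sub K' K -> forall P, allK n K P -> allK n K' P.
Proof. intro H. induction n as [|n IH]; simpl; intros P HP; auto. Qed.

Lemma allK_elim n K : forall P r, allK n K P -> (forall i, i < n -> r i ∈ K) ->
  P (fun i => if i <? n then r i else s0).
Proof.
  induction n as [|n IH]; simpl; intros P r H Hr; auto.
  specialize (IH (fun r' => P (ec (r 0) r')) (fun i => r (S i))).
  replace (fun i => if i <? S n then r i else s0)
    with (ec (r 0) (fun i => if i <? n then r (S i) else s0)).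
  - apply IH; [apply H, Hr; lia|]. intros i Hi. apply Hr. lia.
  - apply functional_extensionality; intros [|i]; reflexivity.
Qed.

(** The hypothesis allows arbitrary terms in both environments because each quantifier of [allK]
    moves a variable from the outer environment to the inner one. *)
Lemma df_allK b1 b2 n : forall (P : env -> env -> Prop) t, tm b2 t ->
  (forall tau tau', (forall i, tm b2 (tau i)) -> (forall i, tm b2 (tau' i)) ->
     df b1 b2 (fun r => P (fun i => tau i r) (fun i => tau' i r))) ->
  df b1 b2 (fun r => allK n (t r) (P r)).
Proof.
  induction n as [|n IH]; intros P t Ht H; simpl.
  - apply (H (fun i r => r i) (fun _ _ => s0)); intro; tms.
  - apply (df_all (fun r y => y ∈ t r -> allK n (t r) (fun r' => P r (ec y r')))).
    apply df_imp; [dfs|].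
    apply (IH (fun r r' => P (fun i => r (S i)) (ec (r 0) r'))); [tms|].
    intros tau tau' T1 T2.
    eapply df_ext; [|apply (H (fun i => tau (S i)) (ec (tau 0) tau'))]; auto.
    + intro r. cbv beta. rewrite (ec_comp (fun t : env -> D => t r)). apply iff_refl.
    + intros [|i]; simpl; auto.
Qed.

(** Induction on the number of parameters, with one use of collection for each. *)
Lemma bound_ex n : forall Q : env -> D -> Prop,
  df true false (fun r => Q (fun i => r (S i)) (r 0)) ->
  forall K, exists L, level L /\
    allK n K (fun r => (exists x, Q r x) -> exists x, x ∈ L /\ Q r x).
Proof.
  induction n as [|n IH]; intros Q HQ K; simpl.
  - destruct (classic (exists x, Q (fun _ => s0) x)) as [[x Hx]|N].
    + destruct (in_level x) as [L [H1 H2]]. exists L. eauto.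
    + destruct (in_level s0) as [L [H1 H2]]. exists L. tauto.
  - assert (dQ : forall t sigma, tm false t -> (forall i, tm false (sigma i)) ->
      df true false (fun r => Q (fun i => sigma i r) (t r))).
    { intros t sigma T1 T2. apply (df_subst true false _ (ec t sigma) HQ).
      intros [|i]; simpl; auto. }
    apply (collection_least (fun y L => allK n K (fun r =>
      (exists x, Q (ec y r) x) -> exists x, x ∈ L /\ Q (ec y r) x))).
    + apply (df_allK true false n (fun r r' =>
        (exists x, Q (ec (r 0) r') x) -> exists x, x ∈ r 1 /\ Q (ec (r 0) r') x) (fun _ => K));
        [tms|].
      intros tau tau' T1 T2.
      assert (dQ' : df true false (fun r =>
        Q (ec (tau 0 (fun i => r (S i))) (fun i => tau' i (fun i => r (S i)))) (r 0))).
      { eapply df_ext; [|apply (dQ (fun r => r 0)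
          (ec (fun r => tau 0 (fun i => r (S i))) (fun j r => tau' j (fun i => r (S i)))))].
        - intro r. cbv beta. rewrite (ec_comp (fun t : env -> D => t r)). apply iff_refl.
        - tms.
        - intros [|i]; simpl; [specialize (T1 0)|specialize (T2 i)]; tms. }
      pose proof (T1 1).
      apply df_imp; [apply (df_ex (fun r x => Q (ec (tau 0 r) (fun i => tau' i r)) x)); exact dQ'|].
      apply (df_ex (fun r x => x ∈ tau 1 r /\ Q (ec (tau 0 r) (fun i => tau' i r)) x)).
      apply df_and; [dfs|exact dQ'].
    + intros y Hy. apply (IH (fun r x => Q (ec y r) x)).
      eapply df_ext; [|apply (dQ (fun r => r 0) (ec (fun _ => y) (fun i r => r (S i))))].
      * intro r. cbv beta. rewrite (ec_comp (fun t : env -> D => t r)). apply iff_refl.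
      * tms.
      * intros [|i]; simpl; tms.
    + intros y L L' H HL' Hs. revert H. apply allK_mono. intros r H Hr.
      destruct (H Hr) as [x [X1 X2]]. exists x. split; auto.
Qed.

(** The Tarski-Vaught test for the subformulas of [p]: counterexamples with
    parameters in [K] are found in [L]. *)
Fixpoint Bnd (p : form) (K L : D) : Prop :=
  match p with
  | FImp p q => Bnd p K L /\ Bnd q K L
  | FAll p => Bnd p K L /\ allK (nb p) K (fun r =>
      (exists x, ~ sat (ec x r) p) -> exists x, x ∈ L /\ ~ sat (ec x r) p)
  | _ => True
  end.

Lemma Bnd_mono p K L L' : sub L L' -> Bnd p K L -> Bnd p K L'.
Proof.
  intro H. induction p as [i j|i j|i| |p IHp q IHq|p IHp]; simpl; try tauto.
  intros [H1 H2]. split; auto. revert H2. apply allK_mono. intros r K1 K2.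
  destruct (K1 K2) as [x [X1 X2]]. exists x. auto.
Qed.

Lemma Bnd_anti p K K' L : sub K' K -> Bnd p K L -> Bnd p K' L.
Proof.
  intro H. induction p as [i j|i j|i| |p IHp q IHq|p IHp]; simpl; try tauto.
  intros [H1 H2]. split; auto. revert H2. apply allK_anti, H.
Qed.

Lemma df_Bnd b1 b2 p t t' : internal p -> tm b2 t -> tm b2 t' ->
  df b1 b2 (fun r => Bnd p (t r) (t' r)).
Proof.
  intros Hp Ht Ht'. induction p as [i j|i j|i| |p IHp q IHq|p IHp]; simpl; try apply df_cst.
  - destruct Hp. apply df_and; auto.
  - apply df_and; auto.
    apply (df_allK b1 b2 (nb p) (fun r r' => (exists x, ~ sat (ec x r') p) ->
      exists x, x ∈ t' r /\ ~ sat (ec x r') p) t); auto.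
    intros tau tau' T1 T2.
    assert (dQ : df b1 b2 (fun r => ~ sat (ec (r 0) (fun i => tau' i (fun i => r (S i)))) p)).
    { apply df_not.
      eapply df_ext; [|apply (df_sat b1 b2 p
          (ec (fun r => r 0) (fun j r => tau' j (fun i => r (S i)))))]; auto.
      - intro r. cbv beta. rewrite (ec_comp (fun t : env -> D => t r)). apply iff_refl.
      - intros [|i]; simpl; [|specialize (T2 i)]; tms. }
    apply df_imp; [apply (df_ex (fun r x => ~ sat (ec x (fun i => tau' i r)) p)); exact dQ|].
    apply (df_ex (fun r x => x ∈ t' (fun i => tau i r) /\ ~ sat (ec x (fun i => tau' i r)) p)).
    apply df_and; [|exact dQ].
    apply df_mem; [tms|].
    destruct Ht' as [[i ->]|[c [Hc ->]]]; [|apply tm_cst; auto].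
    specialize (T1 i). tms.
Qed.

Lemma Bnd_ex p K : internal p -> exists L, level L /\ Bnd p K L.
Proof.
  intro Hp.
  induction p as [i j|i j|i| |p IHp q IHq|p IHp]; simpl in *;
    try (destruct (in_level s0) as [L [H _]]; exists L; tauto).
  - destruct Hp as [Hp Hq]. destruct (IHp Hp) as [L [H1 H2]]. destruct (IHq Hq) as [L' [K1 K2]].
    destruct (level_total L L' H1 K1) as [E|E].
    + exists L'. repeat split; auto. apply (Bnd_mono p K L); auto.
    + exists L. repeat split; auto. apply (Bnd_mono q K L'); auto.
  - destruct (IHp Hp) as [L [H1 H2]].
    destruct (bound_ex (nb p) (fun r x => ~ sat (ec x r) p)) with (K := K) as [L' [K1 K2]].
    { apply df_not. eapply df_ext; [|apply (df_sat true false p (fun i r => r i)); auto].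
      - intro r. cbv beta. replace (ec (r 0) (fun i => r (S i))) with (fun i => r i); [apply iff_refl|].
        apply functional_extensionality; intros [|i]; reflexivity.
      - intro; tms. }
    destruct (level_total L L' H1 K1) as [E|E].
    + exists L'. repeat split; auto. apply (Bnd_mono p K L); auto.
    + exists L. repeat split; auto. revert K2. apply allK_mono. intros r A B.
      destruct (A B) as [x [X1 X2]]. exists x. auto.
Qed.

Lemma reflection p M : level M ->
  (forall K, level K -> K ∈ M -> exists K', level K' /\ K' ∈ M /\ K ∈ K' /\ Bnd p K K') ->
  forall r, (forall i, r i ∈ M) -> (satd mem st (fun x => x ∈ M) r p <-> sat r p).
Proof.
  intros HM. induction p as [i j|i j|i| |p IHp q IHq|p IHp]; simpl; intros H r Hr; try tauto.
  - rewrite (IHp), (IHq); auto; try tauto.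
    + intros K K1 K2. destruct (H K K1 K2) as [K' H']. exists K'. tauto.
    + intros K K1 K2. destruct (H K K1 K2) as [K' H']. exists K'. tauto.
  - assert (IH : forall x, x ∈ M ->
      (satd mem st (fun x => x ∈ M) (ec x r) p <-> sat (ec x r) p)).
    { intros x Hx. apply IHp.
      - intros K K1 K2. destruct (H K K1 K2) as [K' H']. exists K'. tauto.
      - intros [|i]; simpl; auto. }
    split; intros A x Hx; [|apply IH; auto].
    apply NNPP. intro N.
    (* Finitely many parameters lie in a single level below [M]: each is included in some level of
       [M], and [M] has no last level. *)
    assert (B : forall n, exists K, level K /\ K ∈ M /\ forall i, i < n -> r i ∈ K).
    { induction n as [|n [K [K1 [K2 K3]]]].
      - destruct (level_acc M (r 0) HM (Hr 0)) as [K [K1 [K2 _]]].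
        exists K. repeat split; auto; lia.
      - destruct (level_acc M (r n) HM (Hr n)) as [L [L1 [L2 L3]]].
        destruct (H L L1 L2) as [L' [A1 [A2 [A3 _]]]].
        assert (Hn : r n ∈ L') by (apply (level_super L' L); auto).
        destruct (level_total K L' K1 A1) as [E|E].
        + exists L'. repeat split; auto. intros i Hi.
          destruct (Nat.eq_dec i n) as [->|]; auto. apply E, K3. lia.
        + exists K. repeat split; auto. intros i Hi.
          destruct (Nat.eq_dec i n) as [->|]; auto. apply K3. lia. }
    destruct (B (nb p)) as [K [K1 [K2 K3]]].
    destruct (H K K1 K2) as [K' [A1 [A2 [_ [_ A3]]]]].
    apply allK_elim with (r := r) in A3; auto.
    (* [allK] has replaced the parameters from [nb p] on by [s0], where [p] does not see them. *)
    assert (E : forall y, sat (ec y (fun i => if i <? nb p then r i else s0)) p <-> sat (ec y r) p).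
    { intro y. apply (satd_bounded mem st _ p (nb p)); [apply bounded_nb|].
      intros [|i] Hi; simpl; auto. destruct (Nat.ltb_spec i (nb p)); auto. lia. }
    destruct A3 as [y [Y1 Y2]].
    + exists x. rewrite E. exact N.
    + apply Y2, E, IH; auto.
      * apply (level_trans M K'); auto.
      * apply A, (level_trans M K'); auto.
Qed.

(** * Reflecting levels *)

Variable p0 : form.
Hypothesis Hp0 : internal p0.

(** The reflecting levels: limit levels with ω as an element that are closed under the search for
    counterexamples to subformulas of [p0]. *)
Definition C M := level M /\ (exists w, w ∈ M /\ forall n, n ∈ w <-> isNat n) /\
  forall K, level K -> K ∈ M -> exists K', level K' /\ K' ∈ M /\ K ∈ K' /\ Bnd p0 K K'.

Lemma df_Bnd0 b1 b2 t t' : tm b2 t -> tm b2 t' -> df b1 b2 (fun r => Bnd p0 (t r) (t' r)).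
Proof. apply df_Bnd, Hp0. Qed.
Hint Resolve df_Bnd0 : dfdb.
Lemma df_C b1 b2 t : tm b2 t -> df b1 b2 (fun r => C (t r)).
Proof. intros. unfold C. dfs. Qed.
Hint Resolve df_C : dfdb.

Lemma C_next M K : C M -> level K -> K ∈ M -> exists K', level K' /\ K' ∈ M /\ K ∈ K'.
Proof. intros [_ [_ H]] H1 H2. destruct (H K H1 H2) as [K' H']. exists K'. tauto. Qed.

Lemma C_acc M x : C M -> x ∈ M -> exists K, level K /\ K ∈ M /\ x ∈ K.
Proof.
  intros HM Hx. destruct (level_acc M x (proj1 HM) Hx) as [K [K1 [K2 K3]]].
  destruct (C_next M K HM K1 K2) as [L [L1 [L2 L3]]]. exists L. repeat split; auto.
  apply (level_super L K); auto.
Qed.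

Lemma C_join M x y : C M -> x ∈ M -> y ∈ M -> exists K, level K /\ K ∈ M /\ x ∈ K /\ y ∈ K.
Proof.
  intros HM Hx Hy. destruct (C_acc M x HM Hx) as [K [K1 [K2 K3]]].
  destruct (C_acc M y HM Hy) as [L [L1 [L2 L3]]].
  destruct (level_total K L K1 L1) as [E|E]; [exists L|exists K]; auto.
Qed.

(** If [U] and [V] lie in a level [K] of [M], the members of a Kuratowski pair are subsets of [K],
    the pair is a subset of the next level, and [G] is a subset of the one after that, still inside
    [M]. *)
Lemma C_rel M U V G : C M -> U ∈ M -> V ∈ M ->
  (forall p, p ∈ G -> exists a b, Op a b p /\ a ∈ U /\ b ∈ V) -> G ∈ M.
Proof.
  intros HM HU HV HG. destruct (C_join M U V HM HU HV) as [K [K1 [K2 [K3 K4]]]].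
  destruct (C_next M K HM K1 K2) as [K' [A1 [A2 A3]]].
  destruct (C_next M K' HM A1 A2) as [K'' [B1 [B2 B3]]].
  apply (level_super M K''); auto; [apply HM|].
  intros p Hp. destruct (HG p Hp) as [a [b [P1 [P2 P3]]]].
  apply (level_super K'' K'); auto. intros z Hz. apply (level_super K' K); auto.
  apply P1 in Hz. intros w Hw.
  assert (a ∈ K) by (apply (level_trans K U); auto).
  assert (b ∈ K) by (apply (level_trans K V); auto).
  destruct Hz as [Hz|Hz]; apply Hz in Hw; [|destruct Hw]; subst; auto.
Qed.

Lemma C_Op M a b p : C M -> a ∈ M -> b ∈ M -> Op a b p -> p ∈ M.
Proof.
  intros HM Ha Hb Hp. destruct (C_join M a b HM Ha Hb) as [K [K1 [K2 [K3 K4]]]].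
  destruct (upair_ex p p) as [G HG].
  assert (H : G ∈ M).
  { apply (C_rel M K K G); auto. intros q Hq. exists a, b.
    apply HG in Hq. assert (q = p) by tauto. subst. auto. }
  apply (level_trans M G); [apply HM|auto|]. apply HG. auto.
Qed.

Lemma C_Emp M e : C M -> Emp e -> e ∈ M.
Proof.
  intros [HM [[w [Hw _]] _]] He. apply (level_super M w); auto.
  intros z Hz. destruct (He z Hz).
Qed.

Lemma C_nat M n : C M -> isNat n -> n ∈ M.
Proof. intros [HM [[w [H1 H2]] _]] Hn. apply (level_trans M w); auto. apply H2, Hn. Qed.

(** From a level containing [x] and ω, pass ω times to the least level that answers the
    Tarski-Vaught test for the previous one. The union is reflecting, and the iteration itself is
    the cofinal sequence [g]. *)
Lemma C_ex x : exists M g, C M /\ x ∈ M /\ FunNat g /\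
  (forall n v, App g n v -> level v /\ v ∈ M) /\
  (forall z, z ∈ M -> exists n v, App g n v /\ z ∈ v).
Proof.
  set (Q := fun K L => K ∈ L /\ Bnd p0 K L).
  assert (dQ : df true false (fun r => Q (r 0) (r 1))) by (unfold Q; dfs).
  assert (QE : forall K, level K -> exists L, level L /\ Q K L).
  { intros K HK. destruct (Bnd_ex p0 K Hp0) as [L [H1 H2]].
    destruct (level_next K HK) as [L' [K1 K2]].
    destruct (level_total L L' H1 K1) as [E|E].
    - exists L'. split; [|split]; auto. apply (Bnd_mono p0 K L); auto.
    - exists L. split; [|split]; auto. }
  destruct omega_ex as [w Hw].
  assert (Ha : exists a, level a /\ x ∈ a /\ w ∈ a).
  { destruct (in_level x) as [L [H1 H2]]. destruct (in_level w) as [L' [K1 K2]].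
    destruct (level_total L L' H1 K1) as [E|E]; [exists L'|exists L]; auto. }
  destruct Ha as [a [Ha1 [Ha2 Ha3]]].
  (* The second alternative makes the step total, as [recursion] demands; all values of [g] are
     levels, so it is never taken. *)
  destruct (recursion (fun x y => (level x /\ level y /\ Q x y /\
      forall y', level y' -> Q x y' -> sub y y') \/ (~ level x /\ y = x)) a) as [g [G1 [G2 G3]]].
  - dfs.
  - intro K. destruct (classic (level K)) as [HK|HK]; [|exists K; auto].
    destruct (level_least (Q K)) as [L HL]; [dfs|auto|]. exists L. tauto.
  - intros K L L' [H|H] [H'|H']; try tauto.
    + apply sub_antisym; apply H || apply H'; tauto.
    + destruct H as [_ ->], H' as [_ ->]. auto.
  - assert (GL : forall n, isNat n -> forall v, App g n v -> level v).
    { apply (nat_ind_def (fun n => forall v, App g n v -> level v)); [dfs| |].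
      - intros e He v Hv. rewrite (G2 e v He Hv). auto.
      - intros n s Hn IH Hs v Hv. destruct (proj2 (proj2 G1 n) Hn) as [u Hu].
        specialize (IH u Hu). destruct (G3 n s u v Hs Hu Hv); tauto. }
    assert (GN : forall n v, App g n v -> exists s u, App g s u /\ level u /\ Q v u).
    { intros n v Hv. assert (Hn : isNat n) by (apply (proj2 G1); eauto).
      destruct (Suc_ex n) as [s Hs]. pose proof (Nat_Suc n s Hn Hs) as Hns.
      destruct (proj2 (proj2 G1 s) Hns) as [u Hu]. exists s, u.
      pose proof (GL n Hn v Hv). destruct (G3 n s v u Hs Hv Hu); tauto. }
    destruct (range_union_ex g G1) as [M HM].
    assert (GV : forall n v, App g n v -> level v /\ v ∈ M).
    { intros n v Hv. split.
      - apply (GL n); auto. apply (proj2 G1); eauto.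
      - destruct (GN n v Hv) as [s [u [U1 [_ U2]]]]. apply HM. exists s, u.
        split; auto. apply U2. }
    assert (a ∈ M).
    { destruct empty_ex as [e He]. destruct (proj2 (proj2 G1 e) (Nat_Emp e He)) as [v Hv].
      destruct (GV e v Hv) as [_ K]. rewrite (G2 e v He Hv) in K. exact K. }
    assert (LM : level M).
    { apply level_of_union. intros z Hz. apply HM in Hz. destruct Hz as [n [v [V1 V2]]].
      destruct (GV n v V1). exists v. repeat split; auto. intros u Hu. apply HM. eauto. }
    exists M, g. split; [|split; [|split; [|split]]]; auto.
    + split; auto. split.
      * exists w. split; auto. apply (level_trans M a); auto.
      * intros K HK1 HK2. apply HM in HK2. destruct HK2 as [n [v [V1 V2]]].
        destruct (GV n v V1) as [LV VM].
        destruct (GN n v V1) as [s [u [U1 [U2 [U3 U4]]]]].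
        exists u. split; auto. split; [apply (GV s u U1)|]. split.
        -- apply (level_trans u v); auto.
        (* [u] was chosen for parameters in [v], and [K], being a member of [v], is included in
           it. *)
        -- apply (Bnd_anti p0 v); auto. apply level_mem_sub; auto.
    + apply (level_trans M a); auto.
    + intros z Hz. apply HM, Hz.
Qed.

(** * Functional sets and choice functions *)

Definition fn h := forall a X X', App h a X -> App h a X' -> X = X'.
Lemma df_fn b1 b2 t : tm b2 t -> df b1 b2 (fun r => fn (t r)).
Proof. intros. unfold fn. dfs. Qed.
Hint Resolve df_fn : dfdb.

Lemma choice_function (R : D -> D -> Prop) A : df true false (fun r => R (r 0) (r 1)) ->
  (forall a, a ∈ A -> exists h, R a h) ->
  exists s, fn s /\ (forall a h, App s a h -> R a h) /\ forall a, a ∈ A -> exists h, App s a h.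
Proof.
  intros HR HA.
  destruct (collection_least (fun a L => exists h, h ∈ L /\ R a h) A) as [L [HL1 HL2]].
  - dfs.
  - intros a Ha. destruct (HA a Ha) as [h Hh]. destruct (in_level h) as [L [H1 H2]]. eauto.
  - intros a L L' [h [H1 H2]] _ Hs. exists h. auto.
  (* Choice is available for disjoint families only; tagging each candidate with [a] makes the sets
     of candidates disjoint. *)
  - set (Z := fun a z => forall p, p ∈ z <-> exists h, h ∈ L /\ R a h /\ Op a h p).
    assert (ZE : forall a, exists z, Z a z).
    { intro a. destruct (image_ex (fun h p => R a h /\ Op a h p) L) as [z Hz]; [dfs| |].
      - intros h p p' _ [_ H] [_ K]. apply (Op_unique a h); auto.
      - exists z. exact Hz. }
    destruct (image_ex Z A) as [F HF]; [unfold Z; dfs| |].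
    { intros a z z' _ H K. apply extensionality. intro p. rewrite (H p), (K p). tauto. }
    destruct (choice F) as [S HS].
    { split.
      - intros z Hz. apply HF in Hz. destruct Hz as [a [Ha Hz]].
        destruct (HL2 a Ha) as [h [H1 H2]]. destruct (Op_ex a h) as [p Hp].
        exists p. apply Hz. exists h. auto.
      - intros z z' [Hz [Hz' N]] [p [Hp Hp']]. apply N.
        apply HF in Hz. destruct Hz as [a [Ha Hz]].
        apply HF in Hz'. destruct Hz' as [a' [Ha' Hz']].
        apply Hz in Hp. destruct Hp as [h [_ [_ Hp]]].
        apply Hz' in Hp'. destruct Hp' as [h' [_ [_ Hp']]].
        destruct (Op_inj _ _ _ _ _ Hp Hp') as [<- _].
        apply extensionality. intro q. rewrite (Hz q), (Hz' q). tauto. }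
    destruct (relation_ex (fun a h => R a h /\ exists p, Op a h p /\ p ∈ S) A L) as [s [_ Hs]]; [dfs|].
    exists s. split; [|split].
    + intros a h h' H K. apply Hs in H. apply Hs in K.
      destruct H as [H1 [H2 [H3 [p [H4 H5]]]]]. destruct K as [K1 [K2 [K3 [q [K4 K5]]]]].
      destruct (ZE a) as [z Hz].
      destruct (HS z) as [c [C1 [C2 C3]]]; [apply HF; eauto|].
      assert (p = c) by (apply C3; split; auto; apply Hz; eauto).
      assert (q = c) by (apply C3; split; auto; apply Hz; eauto).
      subst. apply (Op_inj _ _ _ _ _ H4 K4).
    + intros a h H. apply Hs in H. tauto.
    + intros a Ha. destruct (ZE a) as [z Hz].
      destruct (HS z) as [c [C1 [C2 C3]]]; [apply HF; eauto|].
      apply Hz in C1. destruct C1 as [h [H1 [H2 H3]]]. exists h. apply Hs.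
      repeat split; auto. eauto.
Qed.

(** * A Hartogs argument for reflecting levels *)

Section Hartogs.
Variable A : D.
Hypothesis HA : C A.

(** There are at most [A] many reflecting levels up to [K]: the counterpart of an ordinal of
    cardinality at most that of [A]. *)
Definition small K := exists h, fn h /\
  forall X, C X -> sub X K -> exists a, a ∈ A /\ App h a X.
Lemma df_small b1 t : tm false t -> df b1 false (fun r => small (t r)).
Proof. intros. unfold small. dfs. Qed.
Hint Resolve df_small : dfdb.

(** [R] codes the order type of the reflecting levels up to [K]. *)
Definition coded R K := exists h, fn h /\
  (forall a X, App h a X -> a ∈ A /\ C X /\ sub X K) /\
  (forall X, C X -> sub X K -> exists a, a ∈ A /\ App h a X) /\
  forall a b, App R a b <-> exists X Y, App h a X /\ App h b Y /\ sub X Y.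
Lemma df_coded b1 t t' : tm false t -> tm false t' ->
  df b1 false (fun r => coded (t r) (t' r)).
Proof. intros. unfold coded. dfs. Qed.
Hint Resolve df_coded : dfdb.

(** A code determines its level because the two indexings agree wherever both are defined. Were [X]
    at [a] in one and a larger [X'] at [a] in the other, the index [b] of [X] in the latter would
    come strictly before [a] in [R]; its value in the former is then below [X], and by induction
    equal to [X]. *)
Lemma coded_le R K K' : C K -> coded R K -> coded R K' -> sub K K'.
Proof.
  intros HK [h [F [H1 [H2 H3]]]] [h' [F' [H1' [H2' H3']]]].
  assert (refl : forall x, sub x x) by (intros x z; auto).
  assert (E : forall X a X', App h a X -> App h' a X' -> X = X').
  { apply (eps_ind (fun X => forall a X', App h a X -> App h' a X' -> X = X')); [dfs|].
    intros X IH a X' HX HX'.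
    destruct (H1 a X HX) as [_ [CX SX]]. destruct (H1' a X' HX') as [_ [CX' SX']].
    destruct (level_linear X (proj1 CX) X' (proj1 CX')) as [E|[E|E]]; auto; exfalso.
    - destruct (H2' X CX) as [b [_ Hb]].
      { intros z Hz. apply SX', (level_trans X' X); auto. apply CX'. }
      assert (Rbb : App R b b) by (apply H3'; eauto).
      apply H3 in Rbb. destruct Rbb as [Y [_ [HY _]]].
      assert (Rba : App R b a).
      { apply H3'. exists X, X'. repeat split; auto. apply level_mem_sub; auto. apply CX'. }
      assert (Rab : ~ App R a b).
      { intro Rab. apply H3' in Rab. destruct Rab as [U [V [U1 [U2 U3]]]].
        rewrite (F' a U X' U1 HX'), (F' b V X U2 Hb) in U3. apply (no_loop X), U3, E. }
      apply H3 in Rba. destruct Rba as [U [V [U1 [U2 U3]]]].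
      rewrite (F b U Y U1 HY), (F a V X U2 HX) in U3.
      destruct (H1 b Y HY) as [_ [CY _]].
      destruct (level_linear Y (proj1 CY) X (proj1 CX)) as [G|[G|G]].
      + rewrite (IH Y G b X HY Hb) in G. exact (no_loop X G).
      + subst Y. apply Rab, H3. eauto.
      + apply (no_loop X), U3, G.
    - destruct (H2 X' CX') as [b [_ Hb]].
      { intros z Hz. apply SX, (level_trans X X'); auto. apply CX. }
      assert (Rbb : App R b b) by (apply H3; eauto).
      apply H3' in Rbb. destruct Rbb as [Y [_ [HY _]]].
      rewrite <- (IH X' E b Y Hb HY) in HY.
      assert (Rab : App R a b) by (apply H3'; eauto).
      apply H3 in Rab. destruct Rab as [U [V [U1 [U2 U3]]]].
      rewrite (F a U X U1 HX), (F b V X' U2 Hb) in U3. apply (no_loop X'), U3, E. }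
  destruct (H2 K HK (refl K)) as [a [_ Ha]].
  assert (Raa : App R a a) by (apply H3; eauto).
  apply H3' in Raa. destruct Raa as [X [_ [HX _]]].
  rewrite (E K a X Ha HX). apply (H1' a X HX).
Qed.

Lemma small_coded K : small K -> exists R,
  (forall p, p ∈ R -> exists a b, Op a b p /\ a ∈ A /\ b ∈ A) /\ coded R K.
Proof.
  intros [h0 [F0 H0]]. destruct (power_ex K) as [PK HPK].
  destruct (relation_ex (fun a X => App h0 a X /\ C X) A PK) as [h [_ Hh]]; [dfs|].
  destruct (relation_ex (fun a b => exists X Y, App h a X /\ App h b Y /\ sub X Y) A A)
    as [R [HR1 HR2]]; [dfs|].
  exists R. split; auto. exists h. split; [|split; [|split]].
  - intros a X X' H K'. apply Hh in H. apply Hh in K'. apply (F0 a); tauto.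
  - intros a X H. apply Hh in H. rewrite HPK in H. tauto.
  - intros X HX1 HX2. destruct (H0 X HX1 HX2) as [a [Ha1 Ha2]]. exists a. split; auto.
    apply Hh. rewrite HPK. auto.
  - intros a b. rewrite HR2. split; [tauto|]. intros [X [Y [H1 [H2 H3]]]].
    split; [apply (Hh a X), H1|]. split; [apply (Hh b Y), H2|]. exists X, Y. auto.
Qed.

(** The codes are subsets of [A × A], hence members of a triple power set of [A], and each codes at
    most one reflecting level; Replacement turns codes into levels. *)
Lemma small_bounded : exists B, forall K, C K -> small K -> K ∈ B.
Proof.
  destruct (power_ex A) as [A1 HA1]. destruct (power_ex A1) as [A2 HA2].
  destruct (power_ex A2) as [A3 HA3].
  destruct (image_ex (fun R K => C K /\ coded R K) A3) as [B HB]; [dfs| |].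
  - intros R K K' _ [H1 H2] [H3 H4]. apply sub_antisym; eapply coded_le; eauto.
  - exists B. intros K H1 H2. apply HB. destruct (small_coded K H2) as [R [R1 R2]].
    exists R. split; auto. apply HA3. intros p Hp. apply HA2. intros z Hz. apply HA1.
    destruct (R1 p Hp) as [a [b [Q1 [Q2 Q3]]]]. apply Q1 in Hz. intros w Hw.
    destruct Hz as [Hz|Hz]; apply Hz in Hw; [|destruct Hw]; subst; auto.
Qed.

Lemma Op_nonempty a b p : Op a b p -> ~ Emp p.
Proof.
  intros H E. destruct (upair_ex a a) as [x Hx]. apply (E x). apply H. left.
  intro w. rewrite Hx. tauto.
Qed.

(** The class of small reflecting levels has cofinality greater than [A]:
    otherwise the first reflecting level beyond it would be small, since
    [A × A ⊆ A] and the empty set is an element of [A] that is not a pair. *)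
Lemma small_regular g : fn g ->
  (forall a X, App g a X -> a ∈ A /\ C X /\ small X) ->
  exists K, C K /\ small K /\ forall a X, App g a X -> X ∈ K.
Proof.
  intros Fg Hg. apply NNPP. intro N.
  (* Without a bound, [g] is cofinal: every small reflecting level is included in one of its
     values. *)
  assert (U : forall K, C K -> small K -> exists a X, App g a X /\ sub K X).
  { intros K H1 H2. apply NNPP. intro N'. apply N. exists K. split; auto. split; auto.
    intros a X HX. destruct (Hg a X HX) as [_ [CX _]].
    destruct (level_linear X (proj1 CX) K (proj1 H1)) as [E|[E|E]]; auto; exfalso; apply N'.
    - exists a, X. subst. split; auto. intros z; auto.
    - exists a, X. split; auto. apply level_mem_sub; auto. apply CX. }
  destruct (level_least (fun L => C L /\ ~ small L)) as [L [L1 [[L2 L3] L4]]]; [dfs| |].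
  { destruct small_bounded as [B HB]. destruct (C_ex B) as [L [_ [H1 [H2 _]]]].
    exists L. split; [apply H1|]. split; auto. intro H. apply (no_cycle L B); auto. }
  apply L3.
  destruct (separation (fun a => exists Y, App g a Y)) with (x := A) as [A' HA']; [dfs|].
  destruct (choice_function (fun a h => exists Y, App g a Y /\ fn h /\
      forall X, C X -> sub X Y -> exists b, b ∈ A /\ App h b X) A') as [s [Fs [Hs1 Hs2]]].
  { dfs. }
  { intros a Ha. apply HA' in Ha. destruct Ha as [_ [Y HY]].
    destruct (Hg a Y HY) as [_ [_ [h [H1 H2]]]]. exists h, Y. auto. }
  destruct (level_next L L1) as [V [HV1 HV2]].
  (* The new indexing of the reflecting levels up to [L]: the pair of [a] and [b] names what the
     chosen indexing for the value of [g] at [a] assigns to [b], and the empty set names [L]. The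
     level [V] serves only as a codomain. *)
  destruct (relation_ex (fun q X => (Emp q /\ X = L) \/
    exists a b h, Op a b q /\ App s a h /\ App h b X) A V) as [h [_ Hh]]; [dfs|].
  exists h. split.
  - intros q X X' H K. apply Hh in H. apply Hh in K.
    destruct H as [_ [_ [[H1 ->]|[a [b [k [H1 [H2 H3]]]]]]]],
             K as [_ [_ [[K1 ->]|[a' [b' [k' [K1 [K2 K3]]]]]]]]; auto.
    + destruct (Op_nonempty _ _ _ K1 H1).
    + destruct (Op_nonempty _ _ _ H1 K1).
    + destruct (Op_inj _ _ _ _ _ H1 K1) as [<- <-]. rewrite (Fs a k' k K2 H2) in K3.
      destruct (Hs1 a k H2) as [Y [_ [Fk _]]]. apply (Fk b); auto.
  - intros X CX SX.
    assert (XV : X ∈ V) by (apply (level_super V L); auto).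
    destruct (classic (X = L)) as [->|NE].
    + destruct empty_ex as [e He]. exists e. pose proof (C_Emp A e HA He).
      split; auto. apply Hh. auto.
    + assert (HX : small X).
      { apply NNPP. intro NS. apply NE. apply sub_antisym; auto. apply L4; auto. apply CX. }
      destruct (U X CX HX) as [a [Y [HY XY]]]. destruct (Hg a Y HY) as [Ha _].
      destruct (Hs2 a) as [k Hk]; [apply HA'; eauto|].
      destruct (Hs1 a k Hk) as [Y' [HY' [Fk Hk']]].
      rewrite (Fg a Y' Y HY' HY) in Hk'. destruct (Hk' X CX XY) as [b [Hb1 Hb2]].
      destruct (Op_ex a b) as [q Hq]. exists q.
      pose proof (C_Op A a b q HA Ha Hb1 Hq). split; auto. apply Hh.
      repeat split; auto. right. exists a, b, k. auto.
Qed.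
End Hartogs.

(** [M] is the union of the reflecting levels small over [A]. All natural numbers lie in [A], so by
    [small_regular] the values of a function from ω to [M] stay inside one such level, which makes
    the function an element of [M]. *)
Lemma uncountable_ex : exists M, C M /\
  forall G, FunNat G -> (forall n v, App G n v -> v ∈ M) -> G ∈ M.
Proof.
  destruct (C_ex s0) as [A [_ [HA _]]].
  pose proof (df_small A) as dS.
  destruct (small_bounded A) as [B HB].
  destruct (separation (fun K => C K /\ small A K)) with (x := B) as [E0 HE0].
  { apply df_and; [dfs|]. apply dS. tms. }
  assert (HE : forall K, K ∈ E0 <-> C K /\ small A K).
  { intro K. rewrite HE0. split; [tauto|]. intros [H1 H2]. auto. }
  destruct (union_ex E0) as [M HM].
  (* There is no largest small level: apply regularity to a family with the constant value [X]. *)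
  assert (EN : forall X, X ∈ E0 -> exists K, K ∈ E0 /\ X ∈ K).
  { intros X HX. destruct empty_ex as [e He]. destruct (upair_ex X X) as [V HV].
    destruct (relation_ex (fun a _ => Emp a) A V) as [g [_ Hg]]; [dfs|].
    assert (VX : forall Y, Y ∈ V -> Y = X) by (intros Y HY; apply HV in HY; tauto).
    destruct (small_regular A HA g) as [K [K1 [K2 K3]]].
    - intros a Y Y' H K. apply Hg in H. apply Hg in K.
      rewrite (VX Y), (VX Y'); tauto.
    - intros a Y H. apply Hg in H. rewrite (VX Y) by tauto. split; [tauto|]. apply HE, HX.
    - exists K. split; [apply HE; auto|]. apply (K3 e). apply Hg.
      split; [apply C_Emp; auto|]. split; auto. apply HV. auto. }
  (* Regularity applied to the empty family yields a first small level. *)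
  assert (E1 : exists K, K ∈ E0).
  { destruct empty_ex as [e He]. destruct (small_regular A HA e) as [K [K1 [K2 _]]].
    - intros a Y Y' [p [H _]]. destruct (He p H).
    - intros a Y [p [H _]]. destruct (He p H).
    - exists K. apply HE. auto. }
  assert (EM : forall X, X ∈ E0 -> X ∈ M).
  { intros X HX. destruct (EN X HX) as [K [K1 K2]]. apply HM. eauto. }
  assert (CM : C M).
  { split; [|split].
    - apply level_of_union. intros z Hz. apply HM in Hz. destruct Hz as [X [X1 X2]].
      pose proof (proj1 (HE X) X1) as [CX _]. exists X. split; [apply CX|].
      repeat split; auto. intros u Hu. apply HM. eauto.
    - destruct E1 as [K K1]. pose proof (proj1 (HE K) K1) as [[_ [[w [W1 W2]] _]] _].
      exists w. split; auto. apply HM. eauto.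
    - intros K K1 K2. apply HM in K2. destruct K2 as [X [X1 X2]].
      pose proof (proj1 (HE X) X1) as [[_ [_ CX]] _].
      destruct (CX K K1 X2) as [K' [A1 [A2 A3]]]. exists K'. split; auto. split; auto.
      apply HM. eauto. }
  exists M. split; auto. intros G FG HG.
  (* [g] sends [n] to the least small reflecting level that contains the value of [G] at [n]. *)
  destruct (relation_ex (fun n X => exists v, App G n v /\ v ∈ X /\
    forall Y, Y ∈ E0 -> v ∈ Y -> sub X Y) A E0) as [g [_ Hg]]; [dfs|].
  destruct (small_regular A HA g) as [K [K1 [K2 K3]]].
  - intros n X X' H K. apply Hg in H. apply Hg in K.
    destruct H as [_ [H1 [v [H2 [H3 H4]]]]]. destruct K as [_ [K1 [v' [K2 [K3 K4]]]]].
    assert (v = v') by (apply (proj2 (proj1 FG) n); auto). subst v'.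
    apply sub_antisym; auto.
  - intros n X H. apply Hg in H. split; [tauto|]. apply HE. tauto.
  - pose proof CM as [_ [[w [W1 W2]] _]].
    apply (C_rel M w K G); auto.
    + apply EM, HE. auto.
    + intros p Hp. destruct (proj1 (proj1 FG) p Hp) as [n [v Hnv]]. exists n, v.
      split; auto.
      assert (HGnv : App G n v) by (exists p; auto).
      assert (Hn : isNat n) by (apply (proj2 FG); eauto).
      split; [apply W2, Hn|].
      pose proof (HG n v HGnv) as HvM. apply HM in HvM. destruct HvM as [Y [Y1 Y2]].
      destruct (level_least (fun X => X ∈ E0 /\ v ∈ X)) as [X [X1 [[X2 X3] X4]]]; [dfs| |].
      { exists Y. split; auto. apply HE in Y1. apply Y1. }
      apply (level_trans K X); [apply K1| |auto].
      apply (K3 n). apply Hg. split; [apply C_nat; auto|]. split; auto.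
      exists v. repeat split; auto. intros Z Z1 Z2. apply X4; auto.
      apply HE in Z1. apply Z1.
Qed.

(** * Finite sets *)

Lemma Fin_Emp e : Emp e -> Fin e.
Proof.
  intro He.
  assert (N : forall a b, ~ App e a b) by (intros a b [p [Hp _]]; exact (He p Hp)).
  exists e. split; [apply Nat_Emp; auto|]. exists e. split; [split|split; [|split]].
  - intros p Hp. destruct (He p Hp).
  - intros a b b' [H _]. destruct (N a b H).
  - intro a. split; [intros [b H]; destruct (N a b H)|]. intro H. destruct (He a H).
  - intro b. split; [intro H; destruct (He b H)|]. intros [a H]. destruct (N a b H).
  - intros a a' b [H _]. destruct (N a b H).
Qed.

Lemma Fin_adjoin B b B' : Fin B -> b ∉ B -> (forall z, z ∈ B' <-> z ∈ B \/ z = b) -> Fin B'.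
Proof.
  intros [n [Hn [f [[F1 F2] [F3 [F4 F5]]]]]] Hb HB.
  destruct (Suc_ex n) as [s Hs]. destruct (Op_ex n b) as [p Hp].
  destruct (adjoin_ex f p) as [f' Hf].
  assert (AF : forall a c, App f' a c <-> App f a c \/ (a = n /\ c = b)).
  { intros a c. destruct (Op_ex a c) as [q Hq].
    rewrite (App_Op f' a c q Hq), (App_Op f a c q Hq), Hf. split.
    - intros [H| ->]; auto. right. apply (Op_inj _ _ _ _ _ Hq Hp).
    - intros [H|[-> ->]]; auto. right. apply (Op_unique n b); auto. }
  assert (Nn : forall c, ~ App f n c).
  { intros c H. apply (no_loop n), F3. eauto. }
  assert (Nb : forall a, ~ App f a b).
  { intros a H. apply Hb, F4. eauto. }
  exists s. split; [eapply Nat_Suc; eauto|]. exists f'. split; [split|split; [|split]].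
  - intros q Hq. apply Hf in Hq. destruct Hq as [Hq| ->]; eauto.
  - intros a c c' [H K]. apply AF in H. apply AF in K.
    destruct H as [H|[-> ->]], K as [K|[E ->]]; subst; auto.
    + eapply F2; eauto.
    + destruct (Nn c H).
    + destruct (Nn c' K).
  - intro a. rewrite (Hs a). split.
    + intros [c H]. apply AF in H. destruct H as [H|[-> _]]; auto. left. apply F3. eauto.
    + intros [H| ->].
      * apply F3 in H. destruct H as [c H]. exists c. apply AF. auto.
      * exists b. apply AF. auto.
  - intro c. rewrite HB. split.
    + intros [H| ->].
      * apply F4 in H. destruct H as [a H]. exists a. apply AF. auto.
      * exists n. apply AF. auto.
    + intros [a H]. apply AF in H. destruct H as [H|[_ ->]]; auto. left. apply F4. eauto.
  - intros a a' c [H K]. apply AF in H. apply AF in K.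
    destruct H as [H|[-> ->]], K as [K|[-> E]]; subst; auto.
    + eapply F5; eauto.
    + destruct (Nb a H).
    + destruct (Nb a' K).
Qed.

(** Induction along the numeral that enumerates [A]: subsets of the image of each of its initial
    segments are finite. *)
Lemma Fin_sub A B : Fin A -> sub B A -> Fin B.
Proof.
  intros [n [Hn [f [[F1 F2] [F3 [F4 F5]]]]]] HB.
  assert (P : forall i, isNat i ->
    forall B, (forall b, b ∈ B -> exists a, a ∈ i /\ App f a b) -> Fin B).
  { apply (nat_ind_def (fun i =>
      forall B, (forall b, b ∈ B -> exists a, a ∈ i /\ App f a b) -> Fin B)); [dfs| |].
    - intros e He B' H. apply Fin_Emp. intros b Hb. destruct (H b Hb) as [a [Ha _]].
      exact (He a Ha).
    - intros i s Hi IH Hs B' H.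
      destruct (classic (exists b, b ∈ B' /\ App f i b)) as [[b [Hb Hib]]|N].
      + destruct (separation (fun z => z <> b)) with (x := B') as [B'' HB'']; [dfs|].
        apply (Fin_adjoin B'' b).
        * apply IH. intros c Hc. apply HB'' in Hc. destruct Hc as [Hc Nc].
          destruct (H c Hc) as [a [Ha Hac]]. apply Hs in Ha.
          destruct Ha as [Ha| ->]; eauto. destruct Nc. apply (F2 i); auto.
        * intro K. apply HB'' in K. tauto.
        * intro z. rewrite HB''. destruct (classic (z = b)) as [->|]; tauto.
      + apply IH. intros c Hc. destruct (H c Hc) as [a [Ha Hac]]. apply Hs in Ha.
        destruct Ha as [Ha| ->]; eauto. destruct N. eauto. }
  apply (P n Hn). intros b Hb. apply HB, F4 in Hb. destruct Hb as [a Ha].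
  exists a. split; auto. apply F3. eauto.
Qed.

(** Finiteness is that of the model, so the bound is built by internal induction along the
    enumeration of [A], keeping the larger of two comparable levels at each step. *)
Lemma Fin_level (P : D -> D -> Prop) M A : C M -> Fin A ->
  df true false (fun r => P (r 0) (r 1)) ->
  (forall a, a ∈ A -> exists K, level K /\ K ∈ M /\ P a K) ->
  (forall a K L, P a K -> sub K L -> P a L) ->
  exists K, level K /\ K ∈ M /\ forall a, a ∈ A -> P a K.
Proof.
  intros CM [n [Hn [f [[F1 F2] [F3 [F4 F5]]]]]] HP H HM.
  assert (Q : forall i, isNat i -> exists K, level K /\ K ∈ M /\
    forall j a, j ∈ i -> App f j a -> P a K).
  { apply (nat_ind_def (fun i => exists K, level K /\ K ∈ M /\
      forall j a, j ∈ i -> App f j a -> P a K)); [dfs| |].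
    - intros e He. destruct (C_acc M e CM (C_Emp M e CM He)) as [K [K1 [K2 _]]].
      exists K. split; auto. split; auto. intros j a Hj. destruct (He j Hj).
    - intros i s Hi [K [K1 [K2 K3]]] Hs.
      destruct (classic (exists a, App f i a)) as [[a Ha]|N].
      + destruct (H a) as [L [L1 [L2 L3]]]; [apply F4; eauto|].
        destruct (level_total K L K1 L1) as [E|E].
        * exists L. split; auto. split; auto. intros j b Hj Hb. apply Hs in Hj.
          destruct Hj as [Hj| ->]; eauto.
          rewrite (F2 i b a); auto.
        * exists K. split; auto. split; auto. intros j b Hj Hb. apply Hs in Hj.
          destruct Hj as [Hj| ->]; eauto.
          rewrite (F2 i b a); eauto.
      + exists K. split; auto. split; auto. intros j b Hj Hb. apply Hs in Hj.
        destruct Hj as [Hj| ->]; eauto. destruct N. eauto. }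
  destruct (Q n Hn) as [K [K1 [K2 K3]]]. exists K. split; auto. split; auto.
  intros a Ha. apply F4 in Ha. destruct Ha as [j Hj]. apply (K3 j); auto. apply F3. eauto.
Qed.

(** * The submodel given by a standard reflecting level *)

(** The subformulas whose meaning must be the same in [M] and in the whole model; [bFin 0 1] comes
    from Idealization, the others from (∗). *)
Definition star_notions : list form :=
  [bFin 0 1; bFunOnNat 0 1; bFunOnNat 1 2; bNat 1 2; bNat 2 3;
   bApp 0 1 2 3; bApp 0 2 3 4; bApp 1 2 3 4].

Definition covered (q : form) : Prop := forall K L, Bnd p0 K L -> Bnd q K L.

Lemma C_reflects M q : C M -> covered q -> forall r, (forall i, r i ∈ M) ->
  (satd mem st (fun x => x ∈ M) r q <-> sat r q).
Proof.
  intros CM Hq. apply reflection; [apply CM|]. intros K K1 K2.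
  destruct (proj2 (proj2 CM) K K1 K2) as [K' [A1 [A2 [A3 A4]]]]. exists K'. auto.
Qed.

Lemma st_Op a b p : st a -> st b -> Op a b p -> st p.
Proof.
  intros Ha Hb Hp. destruct (transfer (fun p => Op a b p)) as [q [Q1 Q2]]; [dfs|eauto|].
  rewrite (Op_unique a b p q); auto.
Qed.

Lemma st_App g n v : st g -> st n -> (forall v v', App g n v -> App g n v' -> v = v') ->
  App g n v -> st v.
Proof.
  intros Hg Hn F Hv. destruct (transfer (fun v => App g n v)) as [u [U1 U2]]; [dfs|eauto|].
  rewrite (F v u); auto.
Qed.

Section Submodel.
Variable M : D.
Hypothesis CM : C M.
Hypothesis stM : st M.
Hypothesis Hstar : forall q, In q star_notions -> covered q.
Notation satM := (satd mem st (fun x => x ∈ M)).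

Lemma df_satM b1 b2 p r : (b1 = true -> internal p) -> (b2 = true -> forall i, st (r i)) ->
  df b1 b2 (fun e => satM (ec (e 0) r) p).
Proof.
  intros Hp Hr.
  eapply df_ext; [|apply (df_satd b1 b2 p Hp (Some (fun _ => M))
    (ec (fun e => e 0) (fun i _ => r i)))].
  - intro e. cbv beta. rewrite (ec_comp (fun t : env -> D => t e)). apply iff_refl.
  - intros t E. injection E as <-. apply tm_cst. auto.
  - intros [|i]; simpl; [tms|]. apply tm_cst. auto.
Qed.

Lemma df_satM2 b1 p r : (b1 = true -> internal p) ->
  df b1 false (fun e => satM (ec (e 0) (ec (e 1) r)) p).
Proof.
  intros Hp.
  eapply df_ext; [|apply (df_satd b1 false p Hp (Some (fun _ => M))
    (ec (fun e => e 0) (ec (fun e => e 1) (fun i _ => r i))))].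
  - intro e. cbv beta. rewrite !(ec_comp (fun t : env -> D => t e)). apply iff_refl.
  - intros t E. injection E as <-. tms.
  - intros [|[|i]]; simpl; tms.
Qed.

Ltac notion lem := rewrite (C_reflects M) by
  (auto; try (apply Hstar; simpl; tauto); intros [|[|[|[|i]]]]; simpl; auto); apply lem.

Lemma satM_transfer n p r : (forall i, r i ∈ M) -> internal p -> bounded (S n) p ->
  satM r (ax_transfer n p).
Proof.
  intros Hr Hp Bp. unfold ax_transfer. intros Hst Hex.
  rewrite stconj_spec in Hst. apply satd_ex in Hex. apply satd_ex.
  (* Only the first [n] parameters are known to be standard; the others, invisible to [p], are
     replaced by the standard set [M]. *)
  set (r' := fun i => if i <? n then r i else M).
  assert (E : forall x, satM (ec x r) p <-> satM (ec x r') p).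
  { intro x. apply (satd_bounded mem st _ p (S n)); auto. intros [|i] Hi; simpl; auto.
    unfold r'. destruct (Nat.ltb_spec i n); auto. lia. }
  destruct (transfer (fun x => x ∈ M /\ satM (ec x r') p)) as [x [X1 [X2 X3]]].
  - apply df_and; [dfs|]. apply df_satM; auto. intros _ i. unfold r'.
    destruct (Nat.ltb_spec i n); auto.
  - destruct Hex as [x [X1 X2]]. exists x. rewrite <- E. auto.
  - exists x. split; auto. apply satd_and. rewrite E. split; auto.
Qed.

Lemma satM_stand p r : (forall i, r i ∈ M) -> satM r (ax_stand p).
Proof.
  intros Hr.
  assert (H : satM r (ax_stand p) <-> forall X, X ∈ M -> st X -> exists Y, Y ∈ M /\
    (st Y /\ forall x, x ∈ M -> st x -> (x ∈ Y <-> x ∈ X /\ satM (ec x r) p))).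
  { unfold ax_stand. semd. embs. }
  apply H. intros X XM Xst.
  destruct (standardization (fun x => satM (ec x r) p)) with (X := X) as [Y [Y1 Y2]]; auto.
  { apply df_satM; discriminate. }
  exists Y. split; auto. apply (level_super M X); auto; [apply CM|].
  (* Inclusion of [Y] in [X] is known for standard elements only; both sets are standard, so
     Transfer extends it to all. *)
  intro z. revert z. apply (transfer_all (fun z => z ∈ Y -> z ∈ X)); [dfs|].
  intros z Hz ZY. apply Y2 in ZY; tauto.
Qed.

Lemma satM_ideal p r : (forall i, r i ∈ M) -> internal p -> satM r (ax_ideal p).
Proof.
  intros Hr Hp. set (P := fun x a => satM (ec x (ec a r)) p).
  assert (H : satM r (ax_ideal p) <->
    ((forall A, A ∈ M -> st A /\ Fin A -> exists x, x ∈ M /\ forall a, a ∈ M -> a ∈ A -> P x a) <->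
     exists x, x ∈ M /\ forall a, a ∈ M -> st a -> P x a)).
  { unfold ax_ideal. semd; try (unfold P; embs). notion sat_Fin. }
  apply H.
  assert (dP : df true false (fun r => P (r 0) (r 1))) by (apply df_satM2; auto).
  (* Both quantifiers are relativized to [M]. The clause [x ∈ M] has to stand under the quantifier
     over [a]; it is recovered by taking [a] to be the standard set [M]. *)
  pose proof (idealization (fun x a => x ∈ M /\ (a ∈ M -> P x a))) as Id. split.
  - intro HA. destruct Id as [Id _]; [dfs|]. destruct Id as [x Hx].
    + intros A [Ast AF].
      (* [A] need not be in [M]. Its trace on [M] is standard and finite, and belongs to [M] because
         a finite subset of a limit level is bounded in it. *)
      destruct (transfer (fun B => forall z, z ∈ B <-> z ∈ A /\ z ∈ M)) as [B [B1 B2]]; [dfs| |].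
      { apply (separation (fun z => z ∈ M)). dfs. }
      assert (BF : Fin B) by (apply (Fin_sub A); auto; intros z Hz; apply B2 in Hz; tauto).
      destruct (Fin_level (fun a K => a ∈ K) M B CM BF) as [K [K1 [K2 K3]]].
      * dfs.
      * intros a Ha. apply C_acc; auto. apply B2 in Ha. tauto.
      * auto.
      * destruct (HA B) as [x [X1 X2]]; auto.
        -- apply (level_super M K); [apply CM|exact K2|exact K3].
        -- exists x. intros a Ha. split; auto. intro Ma. apply X2; auto. apply B2. auto.
    + exists x. split; [apply (Hx M stM)|]. intros a Ma Sa. apply Hx; auto.
  - intros [x [Mx Hx]] A MA HA. destruct Id as [_ Id]; [dfs|].
    destruct (Id (ex_intro _ x (fun a Sa => conj Mx (fun Ma => Hx a Ma Sa))) A HA) as [y Hy].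
    (* For empty [A], the set [y] need not lie in [M], and [x] takes its place. *)
    destruct (classic (exists a, a ∈ A)) as [[a Ha]|N].
    + exists y. split; [apply (Hy a Ha)|]. intros b Mb Hb. apply Hy; auto.
    + exists x. split; auto. intros b _ Hb. destruct N. eauto.
Qed.

Lemma satM_star r : (forall i, r i ∈ M) -> (satM r star <->
  forall F, F ∈ M -> FunNat F ->
    (forall n, n ∈ M -> st n /\ isNat n -> exists v, v ∈ M /\ (App F n v /\ st v)) ->
    exists G, G ∈ M /\ (st G /\ FunNat G /\
      forall n, n ∈ M -> st n /\ isNat n -> exists v, v ∈ M /\ (App F n v /\ App G n v))).
Proof.
  intro Hr. unfold star. semd.
  - notion sat_FunNat0.
  - notion sat_Nat1.
  - notion sat_App012.
  - notion sat_FunNat1.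
  - notion sat_Nat2.
  - notion sat_App023.
  - notion sat_App123.
Qed.

Lemma star_holds r : (forall i, r i ∈ M) ->
  (forall G, FunNat G -> (forall n v, App G n v -> v ∈ M) -> G ∈ M) -> satM r star.
Proof.
  intros Hr HM. apply satM_star; auto. intros F MF FF HF.
  (* [F] may be nonstandard. [G] has the same standard pairs, and its remaining properties follow
     from these by Transfer. *)
  destruct (standardization (fun p => p ∈ F)) with (X := M) as [G [G1 G2]]; auto; [dfs|].
  assert (GA : forall n v, st n -> st v -> App G n v -> v ∈ M /\ App F n v).
  { intros n v Sn Sv H. destruct (Op_ex n v) as [p Hp]. apply (App_Op _ _ _ _ Hp) in H.
    apply G2 in H; [|apply (st_Op n v); auto]. split; [|apply (App_Op _ _ _ _ Hp); tauto].
    destruct (upair_ex n v) as [u Hu].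
    assert (UM : u ∈ M).
    { apply (level_trans M p); [apply CM|tauto|]. apply Hp. right. exact Hu. }
    apply (level_trans M u); [apply CM|auto|]. apply Hu. auto. }
  assert (GF : forall n, st n -> isNat n -> exists v, v ∈ M /\ (App F n v /\ App G n v)).
  { intros n Sn Hn. destruct (HF n) as [v [V1 [V2 V3]]]; auto; [apply C_nat; auto|].
    exists v. split; auto. split; auto. destruct (Op_ex n v) as [p Hp].
    apply (App_Op _ _ _ _ Hp). apply G2; [apply (st_Op n v); auto|].
    split; [|apply (App_Op _ _ _ _ Hp); auto]. apply (C_Op M n v); auto. apply C_nat; auto. }
  assert (GP : forall p, p ∈ G -> exists n v, Op n v p).
  { apply (transfer_all (fun p => p ∈ G -> exists n v, Op n v p)); [dfs|].
    intros p Sp Hp. apply G2 in Hp; auto. apply (proj1 (proj1 FF) p). tauto. }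
  (* One use of Transfer for each quantifier, since the variables already fixed become parameters
     and must be standard. *)
  assert (GU : forall n v v', App G n v -> App G n v' -> v = v').
  { apply (transfer_all (fun n => forall v v', App G n v -> App G n v' -> v = v')); [dfs|].
    intros n Sn. apply (transfer_all (fun v => forall v', App G n v -> App G n v' -> v = v')); [dfs|].
    intros v Sv. apply (transfer_all (fun v' => App G n v -> App G n v' -> v = v')); [dfs|].
    intros v' Sv' H K. apply GA in H; auto. apply GA in K; auto.
    apply (proj2 (proj1 FF) n). tauto. }
  assert (GD : forall n v, App G n v -> v ∈ M /\ isNat n).
  { apply (transfer_all (fun n => forall v, App G n v -> v ∈ M /\ isNat n)); [dfs|].
    intros n Sn. apply (transfer_all (fun v => App G n v -> v ∈ M /\ isNat n)); [dfs|].
    intros v Sv H. destruct (GA n v Sn Sv H). split; auto. apply (proj2 FF). eauto. }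
  assert (FG : FunNat G).
  { split; [split; auto|].
    - intros n v v' [H K]. eauto.
    - intro n. split.
      + intros [v Hv]. apply (GD n v Hv).
      + revert n. apply (transfer_all (fun n => isNat n -> exists v, App G n v)); [dfs|].
        intros n Sn Hn. destruct (GF n Sn Hn) as [v Hv]. exists v. tauto. }
  exists G. split; [|split; [|split]]; auto.
  - apply HM; auto. intros n v H. apply (GD n v H).
  - intros n _ [Sn Hn]. apply GF; auto.
Qed.

Lemma star_fails r g : (forall i, r i ∈ M) -> st g -> FunNat g ->
  (forall n v, App g n v -> level v /\ v ∈ M) ->
  (forall z, z ∈ M -> exists n v, App g n v /\ z ∈ v) -> ~ satM r star.
Proof.
  intros Hr Sg Fg gM gC Hs. pose proof (proj1 (satM_star r Hr) Hs) as H.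
  destruct omega_ex as [w Hw]. destruct empty_ex as [e He].
  assert (wM : w ∈ M).
  { destruct CM as [LM [[w' [W1 W2]] _]]. apply (level_super M w'); auto.
    intros z Hz. apply W2, Hw, Hz. }
  assert (Fun : forall n v v', App g n v -> App g n v' -> v = v').
  { intros n v v' A B. apply (proj2 (proj1 Fg) n); auto. }
  (* Agreement with [g] on a standard finite set is achieved inside [M] by truncating [g];
     Idealization then gives one [F] for all standard arguments. *)
  destruct (proj1 (idealization (fun F a => F ∈ M /\ FunNat F /\
      forall v, App g a v -> App F a v) ltac:(dfs))) as [F HF].
  - intros A [_ AF].
    destruct (Fin_level (fun a K => forall v, App g a v -> v ∈ K) M A CM AF) as [K [K1 [K2 K3]]].
    + dfs.
    + intros a _. destruct (classic (exists v, App g a v)) as [[v Hv]|N].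
      * destruct (C_acc M v CM) as [K [K1 [K2 K3]]]; [apply (gM a v Hv)|].
        exists K. split; auto. split; auto. intros v' Hv'. rewrite (Fun a v' v); auto.
      * destruct (C_acc M w CM wM) as [K [K1 [K2 _]]]. exists K. split; auto. split; auto.
        intros v Hv. destruct N. eauto.
    + intros a K L HK HL v Hv. auto.
    + destruct (C_join M K e CM K2 (C_Emp M e CM He)) as [V [V1 [V2 [V3 V4]]]].
      (* [K] contains the values of [g] on [A]. Replacing the values outside [K] by the empty set
         [e] makes the function bounded, hence an element of [M]. *)
      destruct (relation_ex (fun n v => (App g n v /\ v ∈ K) \/
        (v = e /\ ~ exists u, App g n u /\ u ∈ K)) w V) as [F [F1 F2]]; [dfs|].
      exists F. intros a Ha. split; [|split].
      * apply (C_rel M w V); auto.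
      * split; [split|].
        -- intros p Hp. destruct (F1 p Hp) as [n [v [Q _]]]. eauto.
        -- intros n v v' [A1 A2]. apply F2 in A1. apply F2 in A2.
           destruct A1 as [_ [_ [[A1 A3]|[-> A3]]]], A2 as [_ [_ [[A2 A4]|[-> A4]]]]; eauto.
           ++ destruct A4. eauto.
           ++ destruct A3. eauto.
        -- intro n. split.
           ++ intros [v Hv]. apply F2 in Hv. apply Hw. tauto.
           ++ intro Hn. destruct (classic (exists u, App g n u /\ u ∈ K)) as [[u [U1 U2]]|N].
              ** exists u. apply F2. split; [apply Hw; auto|].
                 split; auto. apply (level_trans V K); auto.
              ** exists e. apply F2. split; [apply Hw; auto|]. auto.
      * intros v Hv. apply F2. split; [apply Hw, (proj2 Fg); eauto|].
        pose proof (K3 a Ha v Hv). split; auto. apply (level_trans V K); auto.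
  - destruct (H F) as [G [MG [SG [FG HG]]]].
    (* Any standard argument would do to extract the clauses that do not depend on it; [M] is at
       hand. *)
    + exact (proj1 (HF M stM)).
    + exact (proj1 (proj2 (HF M stM))).
    + intros n _ [Sn Hn]. destruct (proj2 (proj2 Fg n) Hn) as [v Hv]. exists v.
      split; [apply (gM n v Hv)|]. split; [apply (HF n Sn); auto|].
      apply (st_App g n v); auto. apply Fun.
    + assert (gG : forall n v, App g n v -> App G n v).
      { apply (transfer_all (fun n => forall v, App g n v -> App G n v)); [dfs|].
        intros n Sn v Hv. assert (Hn : isNat n) by (apply (proj2 Fg); eauto).
        destruct (HG n) as [u [_ [U1 U2]]]; auto; [apply C_nat; auto|].
        rewrite (proj2 (proj1 (proj1 (proj2 (HF n Sn)))) n v u); auto.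
        split; auto. apply (HF n Sn); auto. }
      (* A level [K] of [M] containing [G] contains all values of [g], whereas cofinality puts [K]
         into one of them. *)
      destruct (C_acc M G CM MG) as [K [K1 [K2 K3]]].
      destruct (gC K K2) as [n [v [V1 V2]]].
      assert (vK : v ∈ K).
      { destruct (gG n v V1) as [p [P1 P2]]. destruct (upair_ex n v) as [u Hu].
        apply (level_trans K u); auto; [|apply Hu; auto].
        apply (level_trans K p); auto; [apply (level_trans K G); auto|].
        apply P2. right. exact Hu. }
      exact (no_cycle K v V2 vK).
Qed.
End Submodel.

(** * Comparison of the two levels *)

Lemma covered_model M L r : C M -> st M -> (forall q, In q star_notions -> covered q) ->
  (forall q, In q L -> IST_ax q) -> (forall q, In q L -> internal q -> covered q) ->
  (forall i, r i ∈ M) -> forall p, Prv (fun q => In q L) p ->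
  satd mem st (fun x => x ∈ M) r p.
Proof.
  intros CM SM Hs HL HI Hr p Hp. apply (soundness _ _ _ (fun q => In q L)); auto.
  clear p Hp r Hr. intros q Hq r Hr.
  (* Internal axioms pass to [M] by reflection; the three schemes that mention [st] use the
     relativized arguments. *)
  assert (K : internal q -> satd mem st (fun x => x ∈ M) r q).
  { intro Hi. apply C_reflects; auto. }
  pose proof (HL q Hq) as Ax. destruct Ax as [| | | | | | |p Hp|p Hp|p Hp|p|n p Hp Bp];
    try (apply K; simpl; tauto).
  - apply K. simpl. unfold emb. pose proof (fun f => internal_ren p f Hp). intuition.
  - apply K. simpl. unfold emb. pose proof (fun f => internal_ren p f Hp). intuition.
  - apply satM_ideal; auto.
  - apply satM_stand; auto.
  - apply satM_transfer; auto.
Qed.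

Lemma no_internal_equivalent Phi L : covered Phi -> (forall q, In q star_notions -> covered q) ->
  (forall q, In q L -> IST_ax q) -> (forall q, In q L -> internal q -> covered q) ->
  bounded 0 Phi -> Prv (fun q => In q L) (FIff Phi star) -> False.
Proof.
  intros HPhi Hs HL HI B0 HP.
  (* The common reference is the truth value of [Phi] in the whole model; as a sentence, [Phi] has
     the same value in every environment. *)
  assert (E : forall M r, C M -> st M -> (forall i, r i ∈ M) ->
    (satd mem st (fun x => x ∈ M) r star <-> sat (fun _ => s0) Phi)).
  { intros M r CM SM Hr.
    pose proof (covered_model M L r CM SM Hs HL HI Hr _ HP) as H. rewrite satd_iff in H.
    rewrite <- H, (C_reflects M Phi CM HPhi r Hr).
    apply (satd_bounded mem st _ Phi 0); auto. lia. }
  assert (IM : forall M, C M -> exists r : env, forall i, r i ∈ M).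
  { intros M [_ [[w [Hw _]] _]]. exists (fun _ => w). auto. }
  destruct (transfer (fun M => C M /\ exists g, FunNat g /\
    (forall n v, App g n v -> level v /\ v ∈ M) /\
    (forall z, z ∈ M -> exists n v, App g n v /\ z ∈ v))) as [M [SM [CM Hg]]]; [dfs| |].
  { destruct (C_ex s0) as [M [g H]]. exists M. split; [tauto|]. exists g. tauto. }
  (* With [M] now standard, a second Transfer makes the cofinal sequence standard too. *)
  apply transfer in Hg; [|dfs]. destruct Hg as [g [Sg [G1 [G2 G3]]]].
  destruct (transfer (fun M => C M /\
    forall G, FunNat G -> (forall n v, App G n v -> v ∈ M) -> G ∈ M)) as [N [SN [CN HN']]];
    [dfs|exact uncountable_ex|].
  destruct (IM M CM) as [r Hr]. destruct (IM N CN) as [r' Hr'].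
  apply (star_fails M CM SM Hs r g); auto. apply (E M r CM SM Hr).
  apply (E N r' CN SN Hr'). apply star_holds; auto.
Qed.

Lemma Bnd_fold l q K L : In q l -> Bnd (fold_right FImp FBot l) K L -> Bnd q K L.
Proof.
  induction l as [|p l IH]; simpl; [tauto|]. intros [->|H] [H1 H2]; auto.
Qed.
End IST.

Lemma internal_part (L : list form) : exists L', forall q, In q L' <-> In q L /\ internal q.
Proof.
  induction L as [|p L [L' H]].
  - exists []. simpl. tauto.
  - destruct (classic (internal p)) as [Hp|Hp].
    + exists (p :: L'). intro q. simpl. rewrite H. intuition; subst; auto.
    + exists L'. intro q. simpl. rewrite H. intuition; subst; tauto.
Qed.

Theorem theorem1 :
  Consistent IST_ax ->
  ~ (exists Φ : form, internal Φ /\ bounded 0 Φ /\ Prv IST_ax (FIff Φ star)).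
Proof.
  intros Con [Phi [HPhi [B0 HP]]].
  destruct (completeness IST_ax Con) as [D [mem [st [inhD HN]]]].
  destruct (Prv_finite _ _ HP) as [L [HL1 HL2]].
  destruct (internal_part L) as [L' HL'].
  (* [Bnd] of an implication is the conjunction over its two sides, so a chain of implications packs
     the whole list into one formula to be reflected. *)
  set (l := Phi :: star_notions ++ L').
  assert (Hl : internal (fold_right FImp FBot l)).
  { assert (H : forall q, In q l -> internal q).
    { intros q Hq. unfold l in Hq. simpl in Hq.
      repeat (destruct Hq as [<-|Hq]; [simpl; tauto|]). apply HL' in Hq. tauto. }
    clearbody l. induction l as [|q l IH]; simpl in *; auto. }
  assert (Hc : forall q, In q l -> covered mem st inhD HN (fold_right FImp FBot l) q).
  { intros q Hq K K'. apply Bnd_fold, Hq. }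
  apply (no_internal_equivalent mem st inhD HN _ Hl Phi L); auto.
  - apply Hc. simpl. auto.
  - intros q Hq. apply Hc. right. apply in_or_app. auto.
  - intros q Hq Hi. apply Hc. right. apply in_or_app. right. apply HL'. auto.
Qed.
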